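(* A degree sequence is forcibly self-complementary if and only if every realization of it is an elementary self-complementary pseudo-split graph.
   Context: All graphs are finite and simple. The complement $\overline{G}$ of a graph $G$ has vertex set $V(G)$, two distinct vertices being adjacent in $\overline G$ iff they are nonadjacent in $G$; $G$ is self-complementary if $G\cong\overline G$. The degree sequence of a graph is the non-increasing list of its vertex degrees; a ''degree sequence'' means the degree sequence of some graph, and a realization of it is any graph having that degree sequence. A degree sequence is forcibly self-complementary if every realization of it is self-complementary. A split graph is a graph whose vertex set can be partitioned into a clique $K$ and an independent set $I$ (a split partition $K\uplus I$). Let $A_8$ (resp. $B_8$) be the split graph on 8 vertices with clique $K=\{c_1,c_2,c_3,c_4\}$ and independent set $I=\{u_1,u_2,u_3,u_4\}$ whose edges between $K$ and $I$ are: for $A_8$, $u_1\sim c_1,c_2$; $u_2\sim c_1,c_3$; $u_3\sim c_2,c_4$; $u_4\sim c_3,c_4$ (an 8-cycle); for $B_8$, $u_1,u_2\sim c_1,c_2$ and $u_3,u_4\sim c_3,c_4$ (two disjoint $K_{2,2}$). Each of $P_4$ (the path on four vertices), $A_8$, $B_8$ has a unique split partition (for $P_4$: the two inner vertices form the clique, the two ends the independent set). An elementary self-complementary pseudo-split graph is a graph constructed as follows: take $p\ge 0$ vertex-disjoint graphs $S_1,\dots,S_p$, each isomorphic to $P_4$, $A_8$ or $B_8$, with split partitions $K_i\uplus I_i$, and a further set $C$ of $0$, $1$ or $5$ vertices. Add all edges to make $\bigcup_{i}K_i$ a clique; for each $i$, add all edges between $K_i$ and $\bigcup_{j>i} I_j$;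 add all edges between $C$ and $\bigcup_i K_i$; and if $|C|=5$, add edges making $C$ induce a 5-cycle. No other edges are added. *)

(* Defs.v *)
From mathcomp Require Import all_boot.

Set Implicit Arguments.
Unset Strict Implicit.
Unset Printing Implicit Defensive.

Record sgraph := SGraph {
  vertex :> finType;
  adj : rel vertex;
  adj_sym : symmetric adj;
  adj_irr : irreflexive adj
}.

Definition iso (G H : sgraph) : Prop :=
  exists2 f : G -> H, bijective f & forall x y, adj (f x) (f y) = adj x y.

Section Complement.
Variable G : sgraph.
Definition compl_adj : rel G := fun x y => (x != y) && ~~ adj x y.
Lemma compl_sym : symmetric compl_adj.
Proof. by move=> x y; rewrite /compl_adj eq_sym adj_sym. Qed.
Lemma compl_irr : irreflexive compl_adj.
Proof. by move=> x; rewrite /compl_adj eqxx. Qed.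
Definition compl : sgraph := SGraph compl_sym compl_irr.
End Complement.

Definition self_complementary (G : sgraph) : Prop := iso G (compl G).

Definition deg (G : sgraph) (x : G) : nat := #|[set y | adj x y]|.

Definition degseq (G : sgraph) : seq nat := sort geq [seq deg x | x : G].

Definition realization (d : seq nat) (G : sgraph) : Prop := degseq G = d.

Definition degree_sequence (d : seq nat) : Prop :=
  exists G : sgraph, realization d G.

Definition forcibly_self_complementary (d : seq nat) : Prop :=
  forall G : sgraph, realization d G -> self_complementary G.

(* The split partition is [K] together with the complement of [K]. *)
Definition split_partition (G : sgraph) (K : {set G}) : Prop :=
  {in K &, forall x y, x != y -> adj x y} /\
  {in ~: K &, forall x y, ~~ adj x y}.

Section P4.
Definition P4_adj : rel 'I_4 := fun i j => (j == i.+1 :> nat) || (i == j.+1 :> nat).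
Lemma P4_sym : symmetric P4_adj.
Proof. by move=> i j; rewrite /P4_adj orbC. Qed.
Lemma P4_irr : irreflexive P4_adj.
Proof. by move=> i; rewrite /P4_adj ltn_eqF. Qed.
Definition P4 : sgraph := SGraph P4_sym P4_irr.
End P4.

Section C5.
Definition C5_adj : rel 'I_5 :=
  fun i j => (j == i.+1 %% 5 :> nat) || (i == j.+1 %% 5 :> nat).
Lemma C5_sym : symmetric C5_adj.
Proof. by move=> i j; rewrite /C5_adj orbC. Qed.
Lemma C5_irr : irreflexive C5_adj.
Proof. by case; do 5?case=> //. Qed.
Definition C5 : sgraph := SGraph C5_sym C5_irr.
End C5.

(* [inl i] is the clique vertex c_(i+1), [inr i] the independent vertex
   u_(i+1), and [nth [::] nb i] lists the indices, counted from 0, of the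
   clique neighbours of [inr i]. *)
Section Split8.
Variable nb : seq (seq nat).
Definition split8_adj : rel ('I_4 + 'I_4)%type := fun x y =>
  match x, y with
  | inl i, inl j => i != j
  | inl i, inr j => val i \in nth [::] nb j
  | inr i, inl j => val j \in nth [::] nb i
  | inr _, inr _ => false
  end.
Lemma split8_sym : symmetric split8_adj.
Proof. by case=> i [] j //=; rewrite eq_sym. Qed.
Lemma split8_irr : irreflexive split8_adj.
Proof. by case=> i //=; rewrite eqxx. Qed.
Definition split8 : sgraph := SGraph split8_sym split8_irr.
End Split8.

Definition A8 : sgraph :=
  split8 [:: [:: 0; 1]; [:: 0; 2]; [:: 1; 3]; [:: 2; 3]].

Definition B8 : sgraph :=
  split8 [:: [:: 0; 1]; [:: 0; 1]; [:: 2; 3]; [:: 2; 3]].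

(* [inl (Tagged _ x)] with [x : S i] is a vertex of the i-th piece, and
   [inr c] a vertex of [C]. *)
Section Compose.
Variables (p : nat) (S : 'I_p -> sgraph) (K : forall i, {set S i}) (C : sgraph).

Definition in_clique (u : {i : 'I_p & S i}) : bool := tagged u \in K (tag u).

Definition compose_adj : rel ({i : 'I_p & S i} + C)%type := fun x y =>
  match x, y with
  | inl u, inl v =>
      if tag u == tag v then adj (tagged u) (tagged_as u v)
      else [|| in_clique u && in_clique v,
               [&& in_clique u, ~~ in_clique v & tag u < tag v]
             | [&& in_clique v, ~~ in_clique u & tag v < tag u]]
  | inl u, inr _ => in_clique u
  | inr _, inl v => in_clique v
  | inr c, inr c' => adj c c'
  end.
Lemma compose_sym : symmetric compose_adj.
Proof.
case=> [u|c] [v|c'] //=; last exact: adj_sym.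
rewrite eq_sym; case: eqP => [|_]; last first.
  by rewrite andbC; congr (_ || _); rewrite orbC.
case: u v => i x [j y] /= E; case: _ / E x => x.
by rewrite !tagged_asE adj_sym.
Qed.
Lemma compose_irr : irreflexive compose_adj.
Proof.
case=> [u|c] /=; last exact: adj_irr.
by case: u => i x; rewrite eqxx tagged_asE; apply: adj_irr.
Qed.
Definition compose : sgraph := SGraph compose_sym compose_irr.
End Compose.

(* A graph on at most one vertex has no edges, so for |C| <= 1 only the order
   of [C] needs to be prescribed. *)
Definition elementary_sc_pseudo_split (G : sgraph) : Prop :=
  exists (p : nat) (S : 'I_p -> sgraph) (K : forall i, {set S i}) (C : sgraph),
    [/\ forall i, [\/ iso (S i) P4, iso (S i) A8 | iso (S i) B8],
        forall i, split_partition (K i),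
        [\/ #|C| = 0, #|C| = 1 | iso C C5]
      & iso G (compose K C)].

(* Main.v *)
Require Import Defs.
From mathcomp Require Import all_boot.
From mathcomp Require Import zify.

(** Each piece has an antimorphism swapping its clique and its independent
set, and these glue to an antimorphism of an elementary graph.

Conversely, let every realization be self-complementary, let [H] and [L] be the
sets of vertices of maximum degree [D] and minimum degree [dl], and assume
[dl < D].  An antimorphism exchanges [H] and [L], so every realization has
exactly [|H|^2 / 2] edges between [H] and [L]; hence no switch of an alternating
4-cycle may change this number.  This forbids enough configurations to yield
[|H| = 2 dl], so that [L] sends edges only to [H], and dually [H] is a clique
complete to everything outside [L].  The bipartite graph between [H] and [L] is
[dl]-regular and may be replaced by any other such graph; for [dl >= 3] two
switches applied to two disjoint copies of [K_{dl,dl}] leave [dl - 1] twins in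
[L] but not in [H], which no antimorphism allows.  So [dl <= 2], the graph
induced by [H] and [L] is P4, A8 or B8, and one recurses on the other vertices,
whose degrees are again forcibly self-complementary.  In the regular case, of
order [4 j + 1], a realization with a clique but no independent set of order
[2 j] excludes [j >= 2]. *)

Set Implicit Arguments.
Unset Strict Implicit.
Unset Printing Implicit Defensive.

(** * Isomorphism and self-complementarity *)

Lemma iso_sym (G H : sgraph) : iso G H -> iso H G.
Proof.
case=> f [g fK gK] fE; exists g; first by exists f.
by move=> x y; rewrite -fE !gK.
Qed.

Lemma iso_compl (G H : sgraph) : iso G H -> iso (compl G) (compl H).
Proof.
case=> f bf fE; exists f => // x y /=.
by rewrite /compl_adj fE (inj_eq (bij_inj bf)).
Qed.

Lemma iso_trans (G H I : sgraph) : iso G H -> iso H I -> iso G I.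
Proof.
case=> f bf fE [g bg gE]; exists (g \o f); first exact: bij_comp.
by move=> x y /=; rewrite gE fE.
Qed.

Lemma self_complementary_iso (G H : sgraph) :
  iso G H -> self_complementary H -> self_complementary G.
Proof.
move=> GH scH; apply: iso_trans (iso_trans GH scH) _.
exact/iso_compl/iso_sym.
Qed.

(** Outside [K], the vertex [x] would have all its neighbours in [K], hence pairwise adjacent.
    Together with the dual lemma below, this pins down the split partition of a concrete piece
    vertex by vertex. *)
Lemma split_partition_in (G : sgraph) (K : {set G}) (x y z : G) :
  split_partition K -> adj x y -> adj x z -> y != z -> ~~ adj y z -> x \in K.
Proof.
move=> [clK indK] xy xz neq nyz; apply/negPn/negP => xK.
have inK t : adj x t -> t \in K.
  by apply: contraTT => tK; apply: indK; rewrite inE.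
by move: nyz; rewrite clK ?inK.
Qed.

Lemma split_partition_out (G : sgraph) (K : {set G}) (x y z : G) :
  split_partition K -> x != y -> x != z -> ~~ adj x y -> ~~ adj x z ->
  adj y z -> x \notin K.
Proof.
move=> [clK indK] nxy nxz xy xz yz; apply/negP => xK.
have ninK t : x != t -> ~~ adj x t -> t \in ~: K.
  by move=> nxt xt; rewrite inE; apply: contra xt => tK; apply: clK.
by move: yz; apply/negP/indK; apply: ninK.
Qed.

(** * Antimorphisms of the pieces that exchange the clique and the independent set *)

Definition swapping (G : sgraph) (K : {set G}) (f : G -> G) :=
  [/\ injective f, forall x y, compl_adj (f x) (f y) = adj x y
    & forall x, (f x \in K) = (x \notin K)].

Lemma swapping_iso (G H : sgraph) :
  (forall K : {set H}, split_partition K -> exists f, swapping K f) ->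
  iso G H -> forall K : {set G}, split_partition K -> exists f, swapping K f.
Proof.
move=> swH [f [g fK gK] fE] K [clK indK].
have gE x y : adj (g x) (g y) = adj x y by rewrite -fE !gK.
have [|h [hI hE hK]] := swH [set y | g y \in K].
  split=> x y; rewrite !inE => xK yK; rewrite -gE; last by apply: indK; rewrite inE.
  by rewrite -(inj_eq (can_inj gK)); apply: clK.
exists (g \o h \o f); split=> [||x] /=; last first.
- by move: (hK (f x)); rewrite !inE fK.
- move=> x y; rewrite -[RHS]fE -hE /compl_adj.
  by rewrite (inj_eq (can_inj gK)) gE.
- by move=> x y /(can_inj gK)/hI/(can_inj fK).
Qed.

Lemma P4_swapping (K : {set P4}) : split_partition K -> exists f, swapping K f.
Proof.
move=> spK; pose o k : P4 := @inord 3 k.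
have valo k : k < 4 -> val (o k) = k by move=> ?; rewrite /= inordK.
have adjo i j : i < 4 -> j < 4 -> adj (o i) (o j) = (j == i.+1) || (i == j.+1).
  by move=> ? ?; rewrite /= /P4_adj !inordK.
have eqo i j : i < 4 -> j < 4 -> (o i == o j) = (i == j).
  by move=> ? ?; rewrite -val_eqE !valo.
have K0 : (o 0 \in K) = false.
  by apply/negbTE/(split_partition_out (y := o 2) (z := o 3)); rewrite ?eqo ?adjo.
have K1 : o 1 \in K.
  by apply: (split_partition_in (y := o 0) (z := o 2)); rewrite ?eqo ?adjo.
have K2 : o 2 \in K.
  by apply: (split_partition_in (y := o 1) (z := o 3)); rewrite ?eqo ?adjo.
have K3 : (o 3 \in K) = false.
  by apply/negbTE/(split_partition_out (y := o 0) (z := o 1)); rewrite ?eqo ?adjo.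
have oP (x : P4) : exists2 k, k < 4 & x = o k.
  by exists (val x); [case: x | rewrite /o inord_val].
(* The 4-cycle [0 -> 1 -> 3 -> 2 -> 0], which exchanges inner vertices and ends. *)
exists (fun x : P4 => o (nth 0 [:: 1; 3; 0; 2] (val x))); split=> [x y|x y|x].
- have [[|[|[|[|//]]]] _ ->] := oP x; have [[|[|[|[|//]]]] _ ->] := oP y;
  by rewrite !valo //= => /eqP; rewrite eqo.
- have [[|[|[|[|//]]]] _ ->] := oP x; have [[|[|[|[|//]]]] _ ->] := oP y;
  by rewrite !valo // /compl_adj eqo // !adjo.
- by have [[|[|[|[|//]]]] _ ->] := oP x; rewrite valo //= ?(K0, K1, K2, K3).
Qed.

Section Split8Swapping.
Variable nb : seq (seq nat).
Let m (i j : 'I_4) := val i \in nth [::] nb j.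
Hypothesis m_sym : forall i j, m i j = m j i.
Hypothesis m_rev : forall i j, m (rev_ord i) j = ~~ m i j.
Hypothesis m_two : forall j, exists i i', [/\ i != i', m i j & m i' j].

(** The antimorphism sends [c_i] to [u_(rev i)] and [u_i] to [c_i]: by [m_rev] the vertices [c_i]
    and [c_(rev i)] have complementary neighbourhoods among the [u_j]. The two entries given by
    [m_two] are the witnesses that put every [c_i] inside [K] and every [u_i] outside. *)
Lemma split8_swapping (K : {set split8 nb}) :
  split_partition K -> exists f, swapping K f.
Proof.
move=> spK.
have Kc i : inl i \in K.
  have [j [j' [nj mj mj']]] := m_two i.
  apply: (split_partition_in (y := inr j : split8 nb) (z := inr j')) => //=;
  by rewrite -/(m _ _) m_sym.
have Ku i : inr i \notin K.
  have [j [j' [nj mj mj']]] := m_two i.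
  apply: (split_partition_out (y := inl (rev_ord j) : split8 nb)
                              (z := inl (rev_ord j'))) => //.
  - by rewrite -[adj _ _]/(m (rev_ord j) i) m_rev negbK.
  - by rewrite -[adj _ _]/(m (rev_ord j') i) m_rev negbK.
  - by rewrite /= (can_eq rev_ordK).
pose f (x : split8 nb) : split8 nb :=
  match x with inl i => inr (rev_ord i) | inr i => inl i end.
exists f; split.
- pose g (x : split8 nb) : split8 nb :=
    match x with inl i => inr i | inr i => inl (rev_ord i) end.
  by apply: (can_inj (g := g)) => -[] i //=; rewrite rev_ordK.
- case=> i [] j; rewrite /compl_adj.
  + by rewrite andbT (inj_eq inr_inj) (can_eq rev_ordK).
  + by rewrite -[adj _ _]/(m j (rev_ord i)) m_sym m_rev negbK.
  + by rewrite -[adj _ _]/(m i (rev_ord j)) m_sym m_rev negbK.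
  + by rewrite (inj_eq inl_inj) andbN.
- by case=> i /=; rewrite ?Kc ?(negbTE (Ku _)).
Qed.
End Split8Swapping.

Lemma piece_swapping (G : sgraph) (K : {set G}) :
  [\/ iso G P4, iso G A8 | iso G B8] -> split_partition K ->
  exists f, swapping K f.
Proof.
have ex2 (P : 'I_4 -> Prop) i i' (hi : i < 4) (hi' : i' < 4) : i != i' ->
    P (Ordinal hi) -> P (Ordinal hi') ->
    exists i i', [/\ i != i', P i & P i'].
  by move=> ni Pi Pi'; exists (Ordinal hi), (Ordinal hi').
case=> isoG; move: K; apply: swapping_iso isoG => K; first exact: P4_swapping.
- apply: split8_swapping.
  + by move=> [[|[|[|[|//]]]] ?] [[|[|[|[|//]]]] ?].
  + by move=> [[|[|[|[|//]]]] ?] [[|[|[|[|//]]]] ?].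
  + move=> [[|[|[|[|//]]]] ?].
    * by apply: (ex2 _ 0 1).
    * by apply: (ex2 _ 0 2).
    * by apply: (ex2 _ 1 3).
    * by apply: (ex2 _ 2 3).
- apply: split8_swapping.
  + by move=> [[|[|[|[|//]]]] ?] [[|[|[|[|//]]]] ?].
  + by move=> [[|[|[|[|//]]]] ?] [[|[|[|[|//]]]] ?].
  + move=> [[|[|[|[|//]]]] ?].
    * by apply: (ex2 _ 0 1).
    * by apply: (ex2 _ 0 1).
    * by apply: (ex2 _ 2 3).
    * by apply: (ex2 _ 2 3).
Qed.

(** * Elementary graphs are self-complementary *)

Lemma C5_self_complementary : self_complementary C5.
Proof.
(* Doubling modulo 5 exchanges the differences 1, 4 with the differences 2, 3. *)
pose f (i : 'I_5) : 'I_5 := inord (2 * i %% 5).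
have fE i : f i = 2 * i %% 5 :> nat by rewrite inordK ?ltn_mod.
exists (f : C5 -> C5).
  apply: injF_bij => i j /(congr1 val); rewrite /= !fE => eij.
  by apply: val_inj; case: i eij => i ?; case: j => j ? /=; lia.
move=> i j; rewrite /= /compl_adj /= /C5_adj -val_eqE /= !fE.
by case: i => -[|[|[|[|[|//]]]]] ? /=; case: j => -[|[|[|[|[|//]]]]] ? /=.
Qed.

Lemma core_self_complementary (C : sgraph) :
  [\/ #|C| = 0, #|C| = 1 | iso C C5] -> self_complementary C.
Proof.
have small : #|C| <= 1 -> self_complementary C.
  move=> /card_le1_eqP C1; exists id; first by exists id.
  by move=> x y; rewrite (C1 x y) //= /compl_adj adj_irr eqxx.
case=> [C0|C1|isoC]; [by apply: small; rewrite C0|by apply: small; rewrite C1|].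
exact: self_complementary_iso isoC C5_self_complementary.
Qed.

(** Between two pieces, adjacency only asks whether the vertex of the piece of smaller index lies in
    its clique; towards [C], whether the vertex outside [C] does. A swap inside each piece keeps the
    indices and negates clique membership, so it negates these adjacencies too. *)
Lemma elementary_self_complementary (G : sgraph) :
  elementary_sc_pseudo_split G -> self_complementary G.
Proof.
case=> p [S [K [C [pS spK coreC isoG]]]].
apply: self_complementary_iso isoG _.
have [f fP] := fin_all_exists (fun i => piece_swapping (pS i) (spK i)).
have [g gB gE] := core_self_complementary coreC.
pose s (x : compose K C) : compose K C :=
  match x with
  | inl u => inl (Tagged (fun i => S i : Type) (f _ (tagged u)))
  | inr c => inr (g c)
  end.
exists s.
  apply: injF_bij => - [[i x]|c] [[j y]|c'] //=.
  - move=> [] eij; case: _ / eij y => y /eqP.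
    by rewrite eq_Tagged /= => /eqP; case: (fP i) => fI _ _ /fI ->.
  - by move=> [] /(bij_inj gB) ->.
have cl u : in_clique K (Tagged (fun i => S i : Type) (f (tag u) (tagged u))) =
            ~~ in_clique K u.
  by rewrite /in_clique /=; case: (fP (tag u)).
case=> [u|c] [v|c']; rewrite /= /compl_adj /= ?cl ?negbK //; last exact: gE.
rewrite (inj_eq inl_inj); have [euv|nuv] := eqVneq (tag u) (tag v).
  case: u v euv => i x [j y] /= eij; case: _ / eij y => y.
  by rewrite !tagged_asE eq_Tagged /=; case: (fP i) => _ /(_ x y).
case: eqP => [E|_] /=; first by case/eqP: nuv; apply: (congr1 (@tag _ S) E).
have: val (tag u) != val (tag v) by [].
by case: ltngtP => // _ _; do 2!case: in_clique.
Qed.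

(** * Counting, switches, and realizations on a fixed vertex set *)

Lemma sum_rel_card (V : finType) (A : {set V}) (P : pred V) :
  \sum_(y in A) P y = #|[set y in A | P y]|.
Proof.
rewrite -sum1_card big_mkcond [RHS]big_mkcond /=; apply: eq_bigr => y _.
by rewrite !inE; case: (y \in A); case: (P y).
Qed.

Lemma card_toggle (V : finType) (S : {set V}) (b c : V) :
  b \in S -> c \notin S -> #|[set y | (y \in S) (+) (y \in pred2 b c)]| = #|S|.
Proof.
move=> bS cS; have -> : [set y | (y \in S) (+) (y \in pred2 b c)] = c |: (S :\ b).
  apply/setP => y; rewrite !inE.
  have [->|] := eqVneq y c; first by rewrite orbT (negbTE cS).
  by have [->|] := eqVneq y b; rewrite ?bS ?addbF.
rewrite cardsU1 !inE (negbTE cS) andbF.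
by rewrite (cardsD1 b S) bS.
Qed.

Lemma exists_subset_card (V : finType) (X : {set V}) k :
  k <= #|X| -> exists2 A : {set V}, A \subset X & #|A| = k.
Proof.
move=> le_k; exists [set x in take k (enum X)].
  by apply/subsetP => x; rewrite inE => /mem_take; rewrite mem_enum.
rewrite cardsE; have /card_uniqP -> : uniq (take k (enum X)).
  by rewrite take_uniq ?enum_uniq.
by rewrite size_takel // -cardE.
Qed.

Definition antimorphism (V : finType) (e : rel V) (s : V -> V) :=
  injective s /\ forall x y, x != y -> e (s x) (s y) = ~~ e x y.

(** The exclusive or toggles the four pairs [ab], [bc], [cd], [da]. *)
Definition switch (V : finType) (e : rel V) (a b c d : V) : rel V :=
  fun x y => e x y (+) ((x \in pred2 a c) && (y \in pred2 b d)
                     || (y \in pred2 a c) && (x \in pred2 b d)).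

Definition embeds (S : sgraph) (V : finType) (e : rel V) (X : {set V}) :=
  exists f : S -> V,
    [/\ injective f, forall x y, e (f x) (f y) = adj x y & f @: [set: S] = X].

Section Realizations.
Variables (V : finType) (dg : V -> nat).

(** The degree is prescribed at each vertex, not only as a multiset: the sets of vertices of extreme
    degree are then common to all realizations, and switches stay within the class. *)
Definition realizes (e : rel V) :=
  [/\ symmetric e, irreflexive e & forall x, #|[set y | e x y]| = dg x].

(** Each of the four vertices trades one neighbour for another; all other neighbourhoods are
    unchanged. *)
Lemma switch_realizes e a b c d : realizes e ->
  e a b -> ~~ e b c -> e c d -> ~~ e d a ->
  a != c -> b != d -> b != c -> a != d -> realizes (switch e a b c d).
Proof.
case=> sym irr eD ab bc cd da nac nbd nbc nad.
have nab : a != b by apply: contraTneq ab => ->; rewrite irr.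
have ncd : c != d by apply: contraTneq cd => ->; rewrite irr.
split.
- by move=> x y; rewrite /switch sym orbC.
- move=> x; rewrite /switch irr /= orbb !inE.
  have [->|] := eqVneq x a; first by rewrite (negbTE nab) (negbTE nad).
  by have [->|] := eqVneq x c; rewrite ?(negbTE ncd) ?(eq_sym c b) ?(negbTE nbc).
have toggle (x u v : V) : e x u -> ~~ e x v ->
    (forall y, switch e a b c d x y = e x y (+) (y \in pred2 u v)) ->
    #|[set y | switch e a b c d x y]| = dg x.
  move=> xu xv E; rewrite -eD -(@card_toggle _ [set y | e x y] u v) ?inE //.
  by apply: eq_card => y; rewrite !inE E.
have nE (u v : V) : u != v -> ((u == v) = false) * ((v == u) = false).
  by move=> uv; rewrite [v == u]eq_sym (negbTE uv).
pose N := (nE _ _ nab, nE _ _ ncd, nE _ _ nac, nE _ _ nbd, nE _ _ nbc, nE _ _ nad).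
move=> x; have [->|xa] := eqVneq x a.
  apply: (@toggle a b d) => // [|y]; first by rewrite sym.
  by rewrite /switch !inE !N eqxx /= andbF orbF.
have [->|xb] := eqVneq x b.
  apply: (@toggle b a c) => // [|y]; first by rewrite sym.
  by rewrite /switch !inE !N eqxx /= andbT.
have [->|xc] := eqVneq x c.
  apply: (@toggle c d b) => // [|y]; first by rewrite sym.
  by rewrite /switch !inE !N eqxx /= andbF orbF orbC.
have [->|xd] := eqVneq x d.
  apply: (@toggle d c a) => // [|y]; first by rewrite sym.
  by rewrite /switch !inE !N eqxx /= andbT orbC.
rewrite -eD; apply: eq_card => y.
by rewrite !inE /switch !inE (negbTE xa) (negbTE xb) (negbTE xc) (negbTE xd) andbF addbF.
Qed.

(** The non-neighbours of [x] other than [x] are mapped onto the neighbours of [s x]. *)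
Lemma dg_antimorphism e s x :
  realizes e -> antimorphism e s -> (dg (s x) + dg x).+1 = #|V|.
Proof.
case=> sym irr eD [sI sE].
have -> : dg (s x) = #|[set y | (x != y) && ~~ e x y]|.
  rewrite -eD -[RHS](card_imset _ sI); apply: eq_card => y; rewrite inE.
  apply/idP/imsetP => [sxy|[z]]; last first.
    by rewrite inE => /andP[nxz xz] ->; rewrite sE.
  exists (invF sI y); last by rewrite f_invF.
  have nxy : x != invF sI y.
    by apply: contraTneq sxy => /(congr1 s); rewrite f_invF => ->; rewrite irr.
  by rewrite inE nxy -sE // f_invF.
rewrite -eD -[in RHS](cardsC [set y | e x y]) addnC -addnS; congr addn.
rewrite [RHS](cardsD1 x) !inE irr; congr _.+1; apply: eq_card => y.
by rewrite !inE eq_sym.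
Qed.

(** * Edges between the vertices of maximum and of minimum degree *)

Variables D dl : nat.
Hypothesis D_dl : (D + dl).+1 = #|V|.
Hypothesis dl_lt_D : dl < D.
Hypothesis dg_le : forall x, dg x <= D.
Hypothesis FSC : forall e, realizes e -> exists s, antimorphism e s.

Let H := [set x | dg x == D].
Let L := [set x | dg x == dl].

Lemma HL_disj x : x \in H -> x \in L -> False.
Proof. by rewrite !inE => /eqP -> /eqP; lia. Qed.

Section OneRealization.
Variables (e : rel V) (s : V -> V).
Hypothesis eR : realizes e.
Hypothesis eS : antimorphism e s.

Lemma anti_H x : (s x \in H) = (x \in L).
Proof. by have := dg_antimorphism x eR eS; rewrite !inE; lia. Qed.

Lemma anti_L x : (s x \in L) = (x \in H).
Proof. by have := dg_antimorphism x eR eS; rewrite !inE; lia. Qed.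

Lemma dg_ge x : dl <= dg x.
Proof. by have := dg_antimorphism x eR eS; have := dg_le (s x); lia. Qed.

Lemma card_L : #|L| = #|H|.
Proof.
have [sI _] := eS; apply/eqP; rewrite eqn_leq; apply/andP; split.
  rewrite -(card_imset _ sI); apply/subset_leq_card/subsetP => _ /imsetP[x xL ->].
  by rewrite anti_H.
rewrite -(card_imset _ sI); apply/subset_leq_card/subsetP => _ /imsetP[x xL ->].
by rewrite anti_L.
Qed.

End OneRealization.

Definition cnt (e : rel V) := \sum_(x in H) \sum_(y in L) e x y.

Lemma cnt_H e : cnt e = \sum_(x in H) #|[set y in L | e x y]|.
Proof. by apply: eq_bigr => x _; rewrite sum_rel_card. Qed.

Lemma cnt_L e : realizes e -> cnt e = \sum_(y in L) #|[set x in H | e y x]|.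
Proof.
case=> sym _ _; rewrite /cnt exchange_big; apply: eq_bigr => y _.
by rewrite -sum_rel_card; apply: eq_bigr => x _; rewrite sym.
Qed.

(** An antimorphism exchanges [H] and [L] and turns edges between them into non-edges, so exactly
    half of the [|H| * |L|] pairs are edges. *)
Lemma cntE e : realizes e -> 2 * cnt e = #|H| * #|H|.
Proof.
move=> eR; have [s eS] := FSC eR; have [sI sE] := eS.
have E : cnt e = \sum_(x in H) \sum_(y in L) ~~ e x y.
  rewrite exchange_big /= /cnt (reindex_inj sI); apply: eq_big => y.
    by rewrite (anti_H eR eS).
  rewrite (anti_H eR eS) => yL; rewrite (reindex_inj sI).
  apply: eq_big => x; first by rewrite (anti_L eR eS).
  rewrite (anti_L eR eS) => xH; rewrite sE; first by case: eR => ->.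
  by apply/eqP => exy; apply: (@HL_disj x) => //; rewrite -exy.
rewrite mul2n -addnn {2}E -big_split /= -sum_nat_const; apply: eq_bigr => x _.
rewrite -big_split /= -(card_L eR eS) -sum1_card; apply: eq_bigr => y _.
by case: (e x y).
Qed.

(* Switching the alternating 4-cycle a z y b would change [cnt]. *)
Lemma no_increase e a z y b : realizes e -> a \in H -> b \in L ->
  e a z -> ~~ e z y -> e y b -> ~~ e b a -> z != y -> z \notin L -> y \notin H ->
  False.
Proof.
move=> eR aH bL az zy yb ba nzy zL yH.
have nab : a != b by apply/eqP => E; apply: (@HL_disj b) => //; rewrite -E.
have nay : a != y by apply: contraNneq yH => <-.
have nzb : z != b by apply: contraNneq zL => ->.
have e'R := switch_realizes eR az zy yb ba nay nzb nzy nab.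
have: 2 * cnt (switch e a z y b) = 2 * cnt e by rewrite !cntE.
have [sym _ _] := eR.
(* The switch deletes [az] and [yb]. Neither is counted by [cnt], since [z] is outside [L] and [y]
   outside [H], while the new edge [ab] is. *)
have mono u v : u \in H -> v \in L -> e u v <= switch e a z y b u v.
  move=> uH vL; case euv: (e u v) => //; rewrite /switch !inE euv /= lt0b.
  apply/norP; split; apply/andP => - [].
    case/orP=> /eqP E; last by rewrite -E uH in yH.
    case/orP=> /eqP E'; first by rewrite -E' vL in zL.
    by rewrite -E -E' sym euv in ba.
  case/orP=> /eqP E; first by move=> _; apply: (@HL_disj a); rewrite // -E.
  case/orP=> /eqP E'; first by rewrite -E -E' euv in zy.
  by apply: (@HL_disj b) => //; rewrite -E'.
suff lt_cnt : cnt e < cnt (switch e a z y b) by move/eqP; rewrite eqn_pmul2l // gtn_eqF.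
rewrite /cnt (bigD1 a aH) [X in _ < X](bigD1 a aH) /= -addSn.
apply: leq_add; last first.
  by apply: leq_sum => u /andP[uH _]; apply: leq_sum => v vL; apply: mono.
rewrite (bigD1 b bL) [X in _ < X](bigD1 b bL) /= -addSn.
apply: leq_add; last by apply: leq_sum => v /andP[vL _]; apply: mono.
by rewrite sym (negbTE ba) /switch !inE !eqxx sym (negbTE ba) /= orbT.
Qed.

(* An antimorphism maps this configuration to that of [no_increase]. *)
Lemma no_decrease e a b c d : realizes e -> a \in H -> b \in L ->
  e a b -> e c d -> ~~ e c a -> ~~ e d b -> a != c -> b != d ->
  c \notin L -> d \notin H -> False.
Proof.
move=> eR aH bL ab cd ca db nac nbd cL dH; have [s eS] := FSC eR.
have [sI sE] := eS; have [sym irr _] := eR.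
have ncd : c != d by apply: contraTneq cd => ->; rewrite irr.
have nab : a != b by apply: contraTneq ab => ->; rewrite irr.
apply: (@no_increase e (s b) (s d) (s c) (s a)) => //.
- by rewrite (anti_H eR eS).
- by rewrite (anti_L eR eS).
- by rewrite sE // sym.
- by rewrite sE 1?eq_sym // sym cd.
- by rewrite sE 1?eq_sym.
- by rewrite sE // ab.
- by rewrite (inj_eq sI) eq_sym.
- by rewrite (anti_L eR eS).
- by rewrite (anti_H eR eS).
Qed.

(** * The equality [|H| = 2 * dl] *)

Definition nonnb (e : rel V) x := [set y | (x != y) && ~~ e x y].

Lemma card_nonnb e x : realizes e -> (#|nonnb e x| + dg x).+1 = #|V|.
Proof.
case=> sym irr eD; rewrite -eD -[in RHS](cardsC [set y | e x y]) addnC -addnS.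
congr addn; rewrite [RHS](cardsD1 x) !inE irr; congr _.+1.
by apply: eq_card => y; rewrite !inE eq_sym.
Qed.

(** The disjoint sets [H] and [L] have the same size, and [|V| = D + dl + 1 <= 2 * D]. *)
Lemma card_H_le : (exists e, realizes e) -> #|H| <= D.
Proof.
case=> e eR; have [s eS] := FSC eR.
have := card_L eR eS; suff: #|H| + #|L| <= #|V| by lia.
rewrite -cardsUI; have -> : H :&: L = set0; last by rewrite cards0 addn0 max_card.
by apply/setP => x; rewrite in_setI in_set0; apply/andP => -[]; apply: HL_disj.
Qed.

(* If neither inclusion holds, some switch brings one more vertex of [H] into the
   neighbourhood of [b]. *)
Lemma reachable_nested e b : realizes e -> b \in L ->
  exists2 e', realizes e' &
    (H \subset [set y | e' b y]) \/ ([set y | e' b y] \subset H).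
Proof.
move=> + bL; have [n] := ubnP #|[set y in H | ~~ e b y]|.
elim: n e => // n IH e le_n eR.
have [bH|/subsetPn[a aH]] := boolP (H \subset [set y | e b y]).
  by exists e => //; left.
rewrite inE => ba.
have [bH|/subsetPn[y]] := boolP ([set y | e b y] \subset H).
  by exists e => //; right.
rewrite inE => by_ yH; have [sym irr eD] := eR.
have nba : b != a by apply/eqP => E; apply: (@HL_disj b) => //; rewrite E.
have nay : a != y by apply: contraNneq yH => <-.
(* Since [y] is not in [H], its degree is below that of [a]. Discarding the neighbour [b] of [y]
   makes room for [y] itself, and a neighbour [z] of [a] still remains. *)
have /subsetPn[z] : ~~ ([set z | e a z] \subset y |: [set z | e y z] :\ b).
  apply/negP => /subset_leq_card.
  rewrite eD cardsU1 !inE irr andbF add1n.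
  have := cardsD1 b [set z | e y z]; rewrite inE sym by_ eD => E.
  move: aH yH (dg_le y); rewrite !inE => /eqP ->; lia.
rewrite !inE => az /norP[nzy]; rewrite negb_and negbK => zyb.
have nzb : z != b by apply: contraTneq az => ->; rewrite sym.
move: zyb; rewrite (negbTE nzb) /= => yz.
have zL : z \in L.
  apply/negPn/negP => zL.
  by apply: (@no_increase e a z y b); rewrite // 1?sym // sym.
have zyF : ~~ e z y by rewrite sym.
have ybT : e y b by rewrite sym.
have nab : a != b by rewrite eq_sym.
apply: IH (switch_realizes eR az zyF ybT ba nay nzb nzy nab).
move: le_n; rewrite ltnS; apply: leq_trans; apply/proper_card/properP; split.
  apply/subsetP => u; rewrite !inE => /andP[uH]; rewrite uH /=.
  apply: contra => bu; rewrite /switch bu !inE eqxx (negbTE nba).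
  have -> : b == y = false by apply: contraTF ybT => /eqP ->; rewrite irr.
  have -> : u == a = false by apply: contraTF bu => /eqP ->.
  by have -> : u == y = false by apply: contraNF yH => /eqP <-; rewrite inE.
exists a; rewrite !inE.
  by move: aH; rewrite inE => ->.
by rewrite /switch !inE !eqxx (negbTE ba) !orbT andbF.
Qed.

(** Any vertex of [H] has [dl] non-neighbours; here these are exactly the vertices of [L] not
    adjacent to [a], and [|L| = |H|]. *)
Lemma card_L_nb e a : realizes e -> a \in H -> nonnb e a \subset L ->
  #|[set y in L | e a y]| + dl = #|H|.
Proof.
move=> eR aH aL; have [s eS] := FSC eR.
rewrite -(card_L eR eS) -(cardsID [set y | e a y] L); congr addn.
  by apply: eq_card => y; rewrite !inE.
have -> : L :\: [set y | e a y] = nonnb e a.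
  apply/setP => y; rewrite in_setD !inE; apply/andP/andP => -[].
    move=> ay yL; split=> //; apply/eqP => E.
    by apply: (@HL_disj y); rewrite -?E // inE E.
  by move=> nay ay; split=> //; move/subsetP/(_ y): aL; rewrite !inE nay ay; apply.
by have := card_nonnb a eR; move: aH; rewrite inE => /eqP ->; lia.
Qed.

Lemma card_H_nb e b : realizes e -> b \in L ->
  #|[set x in H | e b x]| <= dl ?= iff ([set y | e b y] \subset H).
Proof.
move=> [_ _ eD] bL.
have <- : #|[set y | e b y]| = dl by rewrite eD; move: bL; rewrite inE => /eqP.
have -> : [set x in H | e b x] = H :&: [set y | e b y] by apply/setP => y; rewrite !inE.
rewrite setIC (sameP setIidPl eqP); apply: subset_leqif_cards.
exact: subsetIl.
Qed.

Hypothesis D_max : exists x, dg x == D.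

Lemma card_H_gt0 : 0 < #|H|.
Proof. by case: D_max => x xD; rewrite (cardD1 x) inE xD. Qed.

Lemma cnt_leqif e : realizes e ->
  cnt e <= #|H| * dl ?= iff [forall (b | b \in L), [set y | e b y] \subset H].
Proof.
move=> eR; have [s eS] := FSC eR.
rewrite cnt_L // -(card_L eR eS) -sum_nat_const.
by apply: leqif_sum => b bL; apply: card_H_nb.
Qed.

(** Then [cnt e = |H| * |H| / 2 = |H| * dl], the equality case of [cnt_leqif]. *)
Lemma L_nb_sub_H e b : realizes e -> #|H| = 2 * dl -> b \in L ->
  [set y | e b y] \subset H.
Proof.
move=> eR E bL; have [_] := cnt_leqif eR; have := cntE eR.
have -> : cnt e == #|H| * dl.
  by apply/eqP; have := cntE eR; rewrite {2}E; lia.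
by move=> _ /esym/forall_inP; apply.
Qed.

(** Each vertex of [H] sends [|H| - dl] edges to [L]; compare the total with [cntE]. *)
Lemma card_HE_of_nonnb e :
  realizes e -> (forall a, a \in H -> nonnb e a \subset L) -> #|H| = 2 * dl.
Proof.
move=> eR aL.
have : cnt e = #|H| * (#|H| - dl).
  rewrite cnt_H -sum_nat_const; apply: eq_bigr => a aH.
  by rewrite -(card_L_nb eR aH (aL a aH)) addnK.
have := cntE eR; have [a aD] := D_max; have aH : a \in H by rewrite inE.
have := card_L_nb eR aH (aL a aH); have := card_H_gt0; nia.
Qed.

(** In a realization given by [reachable_nested], if [H] lies in the neighbourhood of [b], then
    [card_HE_of_nonnb] applies. If that neighbourhood lies in [H], then [cnt_leqif] and [cntE] give
    [|H| <= 2 * dl], and the reverse inequality is either its equality case or a double count. *)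
Lemma card_HE : (exists e, realizes e) -> #|H| = 2 * dl.
Proof.
case=> e0 e0R; have [s0 e0S] := FSC e0R.
have h_gt0 := card_H_gt0.
have [b bL] : exists b, b \in L by apply/card_gt0P; rewrite (card_L e0R e0S).
have [e eR nested] := reachable_nested e0R bL.
have {s0 e0S e0R e0} [s eS] := FSC eR; have [sI sE] := eS; have [sym irr eD] := eR.
have bdl : dg b = dl by move: bL; rewrite inE => /eqP.
have dgH x : x \in H -> dg x = D by rewrite inE => /eqP.
case: nested => [Hb|bH].
  apply: (card_HE_of_nonnb eR) => a aH.
  apply/subsetP => x; rewrite inE => /andP[nax ax]; apply/negPn/negP => xL.
  have ba : e b a by move/subsetP/(_ a aH): Hb; rewrite inE.
  (* The right-hand side has [dl] elements, whereas [x], being outside [L], has degree above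
     [dl]. *)
  suff : [set y | e x y] \subset (b |: [set y | e b y]) :\ a.
    move/subset_leq_card; have := cardsD1 a (b |: [set y | e b y]).
    rewrite !inE ba orbT cardsU1 inE irr !eD bdl /= => E.
    have := dg_ge eR eS x; move: xL; rewrite inE; lia.
  apply/subsetP => y; rewrite !inE => xy; apply/andP; split.
    by apply: contraNneq ax => <-; rewrite sym.
  have [//|nyb] := eqVneq y b; apply/negPn/negP => nby.
  apply: (@no_decrease e a b x y) => //.
  - by rewrite sym.
  - by rewrite sym.
  - by rewrite sym.
  - by rewrite eq_sym.
  - by apply: contra nby => /(subsetP Hb); rewrite inE.
have [leif _] := cnt_leqif eR.
have cE := cntE eR.
have cH := card_H_le (ex_intro _ e eR).
(* Each vertex of [S] sends [dl] edges to [S'], each vertex of [S'] sends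
   [#|H| - dl] edges to [L], and [#|S'| <= #|S|]: hence [2 * dl <= #|H|]. *)
pose S := [set b in L | [set y | e b y] \subset H].
pose S' := [set a in H | nonnb e a \subset L].
have [allL|] := boolP [forall (b | b \in L), [set y | e b y] \subset H].
  have := cnt_leqif eR; rewrite allL => -[_ /eqP]; nia.
move=> /forall_inPn[b'' b''L /subsetPn[q]]; rewrite inE => bq qH.
have SS' c : c \in S -> [set y | e c y] \subset S'.
  rewrite inE => /andP[cL cH']; apply/subsetP => a; rewrite inE => ca.
  have aH : a \in H by apply: (subsetP cH'); rewrite inE.
  rewrite inE aH; apply/subsetP => x; rewrite inE => /andP[nax ax].
  apply/negPn/negP => xL.
  (* So [x] has no neighbour outside [H] except possibly [c]. Were [x] itself in [H], it would have
     at most [|H| - 1 < D] neighbours; hence [x] is outside [H], not adjacent to [c], and all its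
     neighbours lie in [H]. *)
  have xN y : e x y -> y != c -> y \in H.
    move=> xy nyc; apply/negPn/negP => yH.
    apply: (@no_decrease e a c x y) => //; rewrite 1?sym // 1?eq_sym //.
    by apply: contra yH => cy; apply: (subsetP cH'); rewrite inE.
  have xH : x \notin H.
    apply/negP => xH.
    suff : [set y | e x y] \subset c |: (H :\ x :\ a).
      move/subset_leq_card; rewrite eD (dgH x) // cardsU1.
      have := cardsD1 x H; have := cardsD1 a (H :\ x).
      rewrite [in a \in _]in_setD1 nax aH xH.
      by move: cH (leq_b1 (c \notin H :\ x :\ a)); clear; lia.
    apply/subsetP => y; rewrite !inE => xy.
    have [//|nyc] := eqVneq y c; have := xN y xy nyc; rewrite inE => -> /=.
    rewrite andbT; apply/andP; split.
      by apply: contraNneq ax => <-; rewrite sym.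
    by apply: contraTneq xy => ->; rewrite irr.
  have xc : ~~ e x c by apply: contra xH => xc; apply: (subsetP cH'); rewrite inE sym.
  have xNH y : e x y -> y \in H.
    by move=> xy; apply: xN => //; apply: contraTneq xy => ->.
  (* By degrees, [x] has a neighbour [p] that [b''] lacks, while [q] is a neighbour of [b''] that
     [x] lacks: the configuration of [no_increase]. *)
  have /subsetPn[p] : ~~ ([set y | e x y] \subset [set y | e b'' y]).
    apply/negP => /subset_leq_card; rewrite !eD.
    move: (dg_ge eR eS x) xL b''L; rewrite !inE => + + /eqP->; clear; lia.
  rewrite !inE => xp bp.
  have xb : ~~ e x b'' by apply/negP => /xNH; move: b''L => /[swap] /HL_disj.
  apply: (@no_increase e p x q b'') => //.
  - exact: xNH.
  - by rewrite sym.
  - by apply: contra qH => /xNH.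
  - by rewrite sym.
  - by apply: contraNneq xb => ->; rewrite sym.
(* [s] maps [S'] into [S]: the neighbours of [s a] are the images of the non-neighbours of [a],
   which lie in [L]. *)
have s_inj_S : #|S'| <= #|S|.
  rewrite -(card_imset _ sI); apply/subset_leq_card/subsetP => _ /imsetP[a aS' ->].
  move: aS'; rewrite inE => /andP[aH aL]; rewrite inE (anti_L eR eS) aH /=.
  apply/subsetP => y; rewrite inE -[y](f_invF sI) => say.
  rewrite (anti_H eR eS); apply: (subsetP aL); rewrite inE.
  have nay : a != invF sI y.
    by apply: contraTneq say => <-; rewrite irr.
  by rewrite nay -sE.
have S_gt0 : 0 < #|S| by apply/card_gt0P; exists b; rewrite inE bL.
have : \sum_(c in S) #|[set a in S' | e c a]| <= \sum_(a in S') #|[set c in L | e a c]|.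
  under eq_bigr do rewrite -sum_rel_card.
  rewrite exchange_big; apply: leq_sum => a _ /=.
  under eq_bigr do rewrite sym.
  rewrite sum_rel_card; apply/subset_leq_card/subsetP => c; rewrite !inE.
  by case/andP=> /andP[-> _].
have -> : \sum_(c in S) #|[set a in S' | e c a]| = #|S| * dl.
  rewrite -sum_nat_const; apply: eq_bigr => c cS.
  have -> : [set a in S' | e c a] = [set a | e c a].
    apply/setP => a; rewrite !in_set; case ca: (e c a); rewrite ?andbF // andbT.
    by have := subsetP (SS' c cS) a; rewrite !in_set; apply.
  by rewrite eD; move: cS; rewrite !inE => /andP[/eqP].
have -> : \sum_(a in S') #|[set c in L | e a c]| = #|S'| * (#|H| - dl).
  rewrite -sum_nat_const; apply: eq_bigr => a; rewrite inE => /andP[aH aL].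
  by rewrite -(card_L_nb eR aH aL) addnK.
nia.
Qed.

(** * The regular bipartite graph between [H] and [L], and the bound [dl < 3] *)

Definition rewire (e F : rel V) : rel V := fun x y =>
  if (x \in H) && (y \in L) then F x y
  else if (x \in L) && (y \in H) then F y x else e x y.

Section Structure.
Variable e : rel V.
Hypothesis eR : realizes e.

Let e_ex : exists e, realizes e. Proof. by exists e. Qed.

(** This is [L_nb_sub_H] for [s a], read back through the antimorphism [s]. *)
Lemma H_nonnb_sub_L a : a \in H -> nonnb e a \subset L.
Proof.
move=> aH; have [s eS] := FSC eR; have [sI sE] := eS.
apply/subsetP => x; rewrite inE => /andP[nax ax].
rewrite -(anti_H eR eS).
have saL : s a \in L by rewrite (anti_L eR eS).
by apply: (subsetP (L_nb_sub_H eR (card_HE e_ex) saL)); rewrite inE sE.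
Qed.

Lemma H_adj x y : x \in H -> y \notin L -> x != y -> e x y.
Proof.
move=> xH yL nxy; apply/negPn/negP => xy; case/negP: yL.
by apply: (subsetP (H_nonnb_sub_L xH)); rewrite inE nxy.
Qed.

Lemma L_nadj x y : x \in L -> y \notin H -> ~~ e x y.
Proof.
move=> xL; apply: contra => xy.
by apply: (subsetP (L_nb_sub_H eR (card_HE e_ex) xL)); rewrite inE.
Qed.

Lemma card_LE : #|L| = 2 * dl.
Proof. by have [s eS] := FSC eR; rewrite (card_L eR eS) card_HE. Qed.

Lemma card_nb_L a : a \in H -> #|[set y in L | e a y]| = dl.
Proof.
move=> aH; have := card_L_nb eR aH (H_nonnb_sub_L aH).
by rewrite (card_HE e_ex); lia.
Qed.

Lemma card_nb_H b : b \in L -> #|[set x in H | e b x]| = dl.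
Proof.
move=> bL; have [_] := card_H_nb eR bL.
by rewrite (L_nb_sub_H eR (card_HE e_ex) bL) => /eqP.
Qed.

(** By [card_nb_L] and [card_nb_H] the bipartite graph replaced is [dl]-regular as well, so no
    degree changes. [F] is only read with its first argument in [H] and its second in [L], so it
    need not be symmetric. *)
Lemma rewire_realizes (F : rel V) :
  (forall a, a \in H -> #|[set y in L | F a y]| = dl) ->
  (forall b, b \in L -> #|[set x in H | F x b]| = dl) -> realizes (rewire e F).
Proof.
have [sym irr eD] := eR => FH FL; split.
- move=> x y; rewrite /rewire sym.
  case xH: (x \in H); case xL: (x \in L); first by case: (HL_disj xH xL).
    by case yH: (y \in H); case yL: (y \in L) => //; case: (HL_disj yH yL).
    by case yH: (y \in H); case yL: (y \in L) => //; case: (HL_disj yH yL).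
  by case yH: (y \in H); case yL: (y \in L) => //; case: (HL_disj yH yL).
- move=> x; rewrite /rewire; case xH: (x \in H); case xL: (x \in L) => //=.
  by case: (HL_disj xH xL).
have split_card X (P Q : pred V) : {in ~: X, P =1 Q} ->
    #|[set y in X | P y]| = #|[set y in X | Q y]| -> #|[set y | P y]| = #|[set y | Q y]|.
  move=> eqC eqX; rewrite -(cardsID X) -[RHS](cardsID X); congr addn.
    rewrite -![_ :&: X]setIC; move: eqX; rewrite !setIdE.
    have D2 (R : pred V) : X :&: [set y | R y] = [set y in X | R y].
      by apply/setP => y; rewrite !inE.
    by rewrite !D2.
  apply: eq_card => y; rewrite !in_setD !in_set.
  by case yX: (y \in X) => //=; apply: eqC; rewrite inE yX.
move=> x; rewrite -eD; case xH: (x \in H).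
  apply: (split_card L) => [y|]; first rewrite inE /rewire => yL.
    rewrite (negbTE yL) andbF; case xL: (x \in L) => //=.
    by case: (HL_disj xH xL).
  rewrite card_nb_L // -(FH x xH); apply: eq_card => y; rewrite !in_set /rewire xH.
  by rewrite [y \in L]inE; case: eqP.
case xL: (x \in L); last by apply: eq_card => y; rewrite !in_set /rewire xH xL.
apply: (split_card H) => [y|]; first rewrite inE /rewire => yL.
  by rewrite (negbTE yL) andbF xH.
rewrite card_nb_H // -(FL x xL); apply: eq_card => y; rewrite !in_set /rewire xH xL.
by rewrite [y \in H]inE; case: eqP.
Qed.

Lemma dl_lt3 : dl < 3.
Proof.
rewrite ltnNge; apply/negP => dl3.
have hH := card_HE e_ex; have hL := card_LE.
have [|A AH cA] := @exists_subset_card _ H dl; first by rewrite hH leq_pmull.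
have [|B BL cB] := @exists_subset_card _ L dl; first by rewrite hL leq_pmull.
have cA' : #|H :\: A| = dl by rewrite cardsD (setIidPr AH) cA hH mul2n -addnn addnK.
have cB' : #|L :\: B| = dl by rewrite cardsD (setIidPr BL) cB hL mul2n -addnn addnK.
have dl2 := ltnW dl3; have dl1 := ltnW dl2.
have /card_gt1P[a1 [a2 [a1A a2A na]]] : 1 < #|A| by rewrite cA.
have /card_gt1P[a1' [a2' [a1A' a2A' na']]] : 1 < #|H :\: A| by rewrite cA'.
have /card_gt1P[b1 [b2 [b1B b2B nb]]] : 1 < #|B| by rewrite cB.
have /card_gt0P[b1' b1B'] : 0 < #|L :\: B| by rewrite cB'.
(* Two disjoint complete bipartite graphs, on [A], [B] and on the complements of [A] in [H] and of
   [B] in [L]. Both switches below use [b1'], so that only this vertex of [L :\: B] is touched. *)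
pose F x y := (x \in A) == (y \in B).
move: a1A' a2A' b1B'; rewrite !in_setD => /andP[a1A' a1H'] /andP[a2A' a2H'] /andP[b1B' b1L'].
have a1H := subsetP AH _ a1A; have a2H := subsetP AH _ a2A.
have b1L := subsetP BL _ b1B; have b2L := subsetP BL _ b2B.
have e0R : realizes (rewire e F).
  apply: rewire_realizes => [a aH|b bL].
    case aA: (a \in A).
      rewrite -[RHS]cB; apply: eq_card => y; rewrite in_set /F aA.
      by case yB: (y \in B); rewrite ?andbF // (subsetP BL).
    rewrite -[RHS]cB'; apply: eq_card => y; rewrite in_set in_setD /F aA.
    by case yB: (y \in B); rewrite ?andbF ?andbT.
  case bB: (b \in B).
    rewrite -[RHS]cA; apply: eq_card => y; rewrite in_set /F bB.
    by case yB: (y \in A); rewrite ?andbF // (subsetP AH).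
  rewrite -[RHS]cA'; apply: eq_card => y; rewrite in_set in_setD /F bB.
  by case yB: (y \in A); rewrite ?andbF ?andbT.
have HLne x y : x \in H -> y \in L -> x == y = false.
  by move=> xH yL; apply/eqP => E; apply: (HL_disj xH); rewrite E.
have neqA (X : {set V}) x y : x \in X -> y \notin X -> x == y = false.
  by move=> xX; apply: contraNF => /eqP <-.
pose e0 := rewire e F.
have e0E x y : x \in H -> y \in L -> e0 x y = F x y.
  by move=> xH yL; rewrite /e0 /rewire xH yL.
have [sym0 irr0 _] := e0R; rewrite -/e0 in sym0 irr0.
have e1R : realizes (switch e0 a1 b1 a1' b1').
  apply: switch_realizes => //.
  - by rewrite e0E // /F a1A b1B.
  - by rewrite sym0 e0E // /F (negbTE a1A') b1B.
  - by rewrite e0E // /F (negbTE a1A') (negbTE b1B').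
  - by rewrite sym0 e0E // /F a1A (negbTE b1B').
  - by rewrite (neqA A).
  - by rewrite (neqA B).
  - by rewrite eq_sym HLne.
  - by rewrite HLne.
pose e1 := switch e0 a1 b1 a1' b1'; rewrite -/e1 in e1R.
have e1E x y : x \in H -> y \in L ->
    e1 x y = F x y (+) ((x \in pred2 a1 a1') && (y \in pred2 b1 b1')).
  move=> xH yL; rewrite /e1 /switch e0E // !inE.
  by rewrite (HLne x b1) // (HLne x b1') //= andbF orbF.
have [sym1 irr1 _] := e1R.
have neq (x y : V) : x != y -> (x == y = false) * (y == x = false).
  by move=> xy; rewrite [y == x]eq_sym (negbTE xy).
have nA x y : x \in A -> y \notin A -> (x == y = false) * (y == x = false).
  by move=> xA yA; apply: neq; rewrite (neqA A).
have nB x y : x \in B -> y \notin B -> (x == y = false) * (y == x = false).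
  by move=> xA yA; apply: neq; rewrite (neqA B).
pose N := (nA _ _ a1A a1A', nA _ _ a1A a2A', nA _ _ a2A a1A', nA _ _ a2A a2A',
           nB _ _ b1B b1B', nB _ _ b2B b1B', neq _ _ na, neq _ _ na', neq _ _ nb).
have e2R : realizes (switch e1 a2 b2 a2' b1').
  apply: switch_realizes => //.
  - by rewrite e1E // /F a2A b2B !inE !N.
  - by rewrite sym1 e1E // /F (negbTE a2A') b2B !inE !N.
  - by rewrite e1E // /F (negbTE a2A') (negbTE b1B') !inE !N.
  - by rewrite sym1 e1E // /F a2A (negbTE b1B') !inE !N.
  - by rewrite !N.
  - by rewrite !N.
  - by rewrite eq_sym HLne.
  - by rewrite HLne.
(* In [e2] all vertices of [L :\: B] but [b1'] are twins, whereas a vertex of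
   [H] is determined by its adjacency to [b1], [b2], [b1'], up to membership in
   [A :\ a1 :\ a2] or [(H :\: A) :\ a1' :\ a2']. *)
pose e2 := switch e1 a2 b2 a2' b1'; rewrite -/e2 in e2R.
have e2E x y : x \in H -> y \in L ->
    e2 x y = F x y (+) ((x \in pred2 a1 a1') && (y \in pred2 b1 b1'))
                   (+) ((x \in pred2 a2 a2') && (y \in pred2 b2 b1')).
  move=> xH yL; rewrite /e2 /switch e1E // !inE.
  by rewrite (HLne x b2) // (HLne x b1') //= andbF orbF.
have [sym2 irr2 _] := e2R.
have [s eS] := FSC e2R; have [sI sE] := eS.
pose T := (L :\: B) :\ b1'.
have cT : #|T|.+1 = dl by rewrite -cB' (cardsD1 b1' (L :\: B)) in_setD b1B' b1L'.
have TL c : c \in T -> c \in L by rewrite !in_setD => /and3P[].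
(* Within [H], each vertex of [T] is adjacent exactly to [H :\: A]. So the adjacency of [s c] to [L]
   does not depend on [c]: the images of the twins are twins towards [L]. *)
have sT c y : c \in T -> y \in L -> e2 (s c) y = (invF sI y \in A).
  move=> cT' yL; have cL := TL c cT'.
  have xH : invF sI y \in H by rewrite -(anti_L e2R eS) f_invF.
  rewrite -{1}[y](f_invF sI) sE; last by rewrite eq_sym HLne.
  rewrite sym2 e2E // /F !inE.
  move: cT'; rewrite !in_setD in_set1 => /and3P[cb1' cB'' _].
  rewrite (negbTE cb1') (negbTE cB'') !orbF.
  have -> : c == b1 = false by apply: contraNF cB'' => /eqP ->.
  have -> : c == b2 = false by apply: contraNF cB'' => /eqP ->.
  by rewrite !andbF !addbF; case: (_ \in A).
have [c cT0] : exists c, c \in T by apply/card_gt0P; rewrite -ltnS cT.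
have sTH c0 : c0 \in T -> s c0 \in H by move=> /TL; rewrite (anti_H e2R eS).
have same c0 : c0 \in T -> [/\ (s c0 \in A) = (s c \in A),
     (s c0 \in pred2 a1 a1') = (s c \in pred2 a1 a1')
   & (s c0 \in pred2 a2 a2') = (s c \in pred2 a2 a2')].
  move=> c0T; have eqv y : y \in L -> e2 (s c0) y = e2 (s c) y.
    by move=> yL; rewrite !sT.
  have xx x : (x \in pred2 a1 a1') && (x \in pred2 a2 a2') = false.
    rewrite !inE; have [->|_] := eqVneq x a1; first by rewrite !N.
    by have [->|_] := eqVneq x a1'; rewrite ?N.
  have := xx (s c0); have := xx (s c).
  have := eqv b1 b1L; have := eqv b2 b2L; have := eqv b1' b1L'.
  rewrite !e2E ?sTH // /F b1B b2B (negbTE b1B').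
  rewrite ![_ \in pred2 b1 b1']inE ![_ \in pred2 b2 b1']inE !N !eqxx /=.
  rewrite !andbT !andbF !addbF.
  by case: (s c0 \in A) (s c \in A) (s c0 \in pred2 a1 a1') (s c \in pred2 a1 a1')
       (s c0 \in pred2 a2 a2') (s c \in pred2 a2 a2') => [] [] [] [] [] [].
have cU : #|s @: T|.+1 = dl by rewrite card_imset.
(* The image of [T] has [dl - 1] elements, but lies in one class of vertices of [H] with equal
   adjacency to [b1], [b2], [b1']. Such a class has 1 or [dl - 2] elements, too few since
   [dl >= 3]. *)
have small (X : {set V}) : #|X|.+1 < dl -> ~ (s @: T \subset X).
  by move=> lt_dl /subset_leq_card; move: lt_dl; rewrite -cU ltnS ltnNge => /negP.
have sub (X : {set V}) : (forall c0, c0 \in T -> s c0 \in X) -> s @: T \subset X.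
  by move=> sTX; apply/subsetP => _ /imsetP[c0 c0T ->]; apply: sTX.
case p1: (s c \in pred2 a1 a1').
  apply: (small [set if s c \in A then a1 else a1']); first by rewrite cards1.
  apply: sub => c0 /same[<-]; rewrite p1 !inE => + _.
  by case/orP=> /eqP ->; rewrite ?a1A ?(negbTE a1A').
case p2: (s c \in pred2 a2 a2').
  apply: (small [set if s c \in A then a2 else a2']); first by rewrite cards1.
  apply: sub => c0 /same[<- _]; rewrite p2 !inE.
  by case/orP=> /eqP ->; rewrite ?a2A ?(negbTE a2A').
case pA: (s c \in A).
  apply: (small (A :\ a1 :\ a2)).
    have := cardsD1 a1 A; have := cardsD1 a2 (A :\ a1).
    by rewrite !in_setD1 a1A a2A !N cA /=; clear; lia.
  apply: sub => c0 /same[]; rewrite p1 p2 pA !in_setD1 => -> .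
  by rewrite !inE => /norP[-> _] /norP[-> _].
apply: (small ((H :\: A) :\ a1' :\ a2')).
  have := cardsD1 a1' (H :\: A); have := cardsD1 a2' ((H :\: A) :\ a1').
  by rewrite !in_setD1 !in_setD a1A' a2A' a1H' a2H' !N cA' /=; clear; lia.
apply: sub => c0 c0T; have [] := same c0 c0T.
rewrite p1 p2 pA !in_setD1 in_setD => -> .
by rewrite sTH // ![_ \in pred2 _ _]inE => /norP[_ ->] /norP[_ ->].
Qed.

(** * Identification of the graph induced by [H] and [L] with P4, A8 or B8 *)

Lemma split8_embeds x0 nb (hs ls : seq V) :
  perm_eq hs (enum H) -> perm_eq ls (enum L) -> size hs = 4 -> size ls = 4 ->
  (forall i j, i < 4 -> j < 4 ->
     e (nth x0 hs i) (nth x0 ls j) = (i \in nth [::] nb j)) ->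
  embeds (split8 nb) e (H :|: L).
Proof.
move=> hsP lsP hs4 ls4 E; have [sym _ _] := eR.
have hsU : uniq hs by rewrite (perm_uniq hsP) enum_uniq.
have lsU : uniq ls by rewrite (perm_uniq lsP) enum_uniq.
have hsE x : (x \in hs) = (x \in H) by rewrite (perm_mem hsP) mem_enum.
have lsE x : (x \in ls) = (x \in L) by rewrite (perm_mem lsP) mem_enum.
have hsH (i : 'I_4) : nth x0 hs i \in H by rewrite -hsE mem_nth ?hs4.
have lsL (i : 'I_4) : nth x0 ls i \in L by rewrite -lsE mem_nth ?ls4.
exists (fun x : split8 nb => match x with inl i => nth x0 hs i | inr i => nth x0 ls i end).
split.
- case=> i [] j.
  + by move=> /eqP; rewrite nth_uniq ?hs4 // => /eqP/val_inj ->.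
  + by move=> ij; case: (@HL_disj (nth x0 hs i)); rewrite ?hsH // ij lsL.
  + by move=> ij; case: (@HL_disj (nth x0 hs j)); rewrite ?hsH // -ij lsL.
  + by move=> /eqP; rewrite nth_uniq ?ls4 // => /eqP/val_inj ->.
- case=> i [] j /=.
  + have [->|nij] := eqVneq i j; first by case: eR => _ ->.
    rewrite H_adj //; last by rewrite nth_uniq ?hs4.
    by apply/negP; apply: HL_disj.
  + exact: E.
  + by rewrite sym; apply: E.
  + by apply/negbTE/L_nadj => //; apply/negP => /HL_disj; apply.
apply/setP => x; apply/imsetP/setUP => [[[] i _ ->]|[]].
- by left; rewrite hsH.
- by right; rewrite lsL.
- rewrite -hsE => /(nthP x0)[i]; rewrite hs4 => i4 <-.
  by exists (inl (Ordinal i4)).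
- rewrite -lsE => /(nthP x0)[i]; rewrite ls4 => i4 <-.
  by exists (inr (Ordinal i4)).
Qed.

Lemma P4_embeds a1 a2 b1 b2 : H = [set a1; a2] -> L = [set b1; b2] ->
  a1 != a2 -> b1 != b2 -> e a1 b1 -> ~~ e a1 b2 -> e a2 b2 -> ~~ e a2 b1 ->
  embeds P4 e (H :|: L).
Proof.
move=> HE LE na nb e11 e12 e22 e21; have [sym irr _] := eR.
have [aH1 aH2] : a1 \in H /\ a2 \in H by rewrite HE !inE !eqxx orbT.
have [bL1 bL2] : b1 \in L /\ b2 \in L by rewrite LE !inE !eqxx orbT.
have HLne x y : x \in H -> y \in L -> x != y.
  by move=> xH yL; apply/eqP => E; apply: (HL_disj xH); rewrite E.
(* The vertices in their order along the path. *)
pose s := [:: b1; a1; a2; b2].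
have sU : uniq s.
  rewrite /= !inE !negb_or na nb [b1 == a1]eq_sym [b1 == a2]eq_sym.
  by rewrite (HLne a1 b1) ?(HLne a1 b2) ?(HLne a2 b1) ?(HLne a2 b2).
have e12' : e a1 a2 by apply: H_adj => //; apply/negP/HL_disj.
have eb : ~~ e b1 b2 by apply: L_nadj => //; apply/negP => /HL_disj; apply.
exists (fun i : P4 => nth b1 s (val i)); split.
- move=> [i i4] [j j4] /= /eqP; rewrite nth_uniq // => /eqP ij.
  exact: val_inj.
- pose E := (irr, e11, e22, e12', negbTE e12, negbTE e21, negbTE eb).
  by move=> [[|[|[|[|//]]]] ?] [[|[|[|[|//]]]] ?] /=; rewrite ?E // sym ?E.
apply/setP => x; have -> : (x \in H :|: L) = (x \in s).
  rewrite in_setU HE LE !inE.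
  by case: (x == b1); case: (x == a1); case: (x == a2); case: (x == b2).
apply/imsetP/(nthP b1) => [[i _ ->]|[i i4 <-]]; last by exists (Ordinal i4).
by exists (val i) => //; apply: (ltn_ord (i : 'I_4)).
Qed.

Lemma sum_H b : b \in L -> \sum_(x <- enum H) e x b == dl.
Proof.
have [sym _ _] := eR; move=> bL; rewrite -(card_nb_H bL) -sum_rel_card big_enum.
by apply/eqP/eq_bigr => x _; rewrite sym.
Qed.

Lemma sum_L a : a \in H -> \sum_(y <- enum L) e a y == dl.
Proof. by move=> aH; rewrite -(card_nb_L aH) -sum_rel_card big_enum. Qed.

(** For [dl = 1] the edges between [H] and [L] form a perfect matching. For [dl = 2] the bipartite
    graph is 2-regular on 4 + 4 vertices, hence an 8-cycle or two disjoint 4-cycles. *)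
Lemma piece_embeds : [\/ embeds P4 e (H :|: L), embeds A8 e (H :|: L)
                       | embeds B8 e (H :|: L)].
Proof.
have hH := card_HE e_ex; have hL := card_LE; have h0 := card_H_gt0.
have : (dl == 1) || (dl == 2).
  by move: hH h0 dl_lt3; clear; case: dl => [|[|[|n]]] // ->.
case/orP=> /eqP dlE.
  constructor 1.
  have /cards2P[a1 [a2 [na HE]]] : #|H| == 2 by rewrite hH dlE.
  have /cards2P[b1 [b2 [nb LE]]] : #|L| == 2 by rewrite hL dlE.
  have sL a : a \in H -> e a b1 (+) e a b2.
    move=> /sum_L; rewrite dlE big_enum LE big_setU1 ?inE //= big_set1.
    by case: (e a b1); case: (e a b2).
  have sH b : b \in L -> e a1 b (+) e a2 b.
    move=> /sum_H; rewrite dlE big_enum HE big_setU1 ?inE //= big_set1.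
    by case: (e a1 b); case: (e a2 b).
  have [aH1 aH2] : a1 \in H /\ a2 \in H by rewrite HE !inE !eqxx orbT.
  have [bL1 bL2] : b1 \in L /\ b2 \in L by rewrite LE !inE !eqxx orbT.
  move: (sH b1 bL1) (sH b2 bL2) (sL a1 aH1) (sL a2 aH2).
  case e11: (e a1 b1); case e12: (e a1 b2); case e21: (e a2 b1); case e22: (e a2 b2) => //= _ _ _ _.
    by apply: (@P4_embeds a1 a2 b1 b2); rewrite ?e11 ?e12 ?e21 ?e22.
  apply: (@P4_embeds a1 a2 b2 b1); rewrite ?e11 ?e12 ?e21 ?e22 //.
    by rewrite LE setUC.
  by rewrite eq_sym.
have := cardE L; rewrite hL dlE.
case EL: (enum L) => [|b1 [|b2 [|b3 [|b4 []]]]] //= _.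
have bL b : b \in [:: b1; b2; b3; b4] -> b \in L by rewrite -EL mem_enum.
pose hs1 := [seq x <- enum H | e x b1]; pose hs2 := [seq x <- enum H | ~~ e x b1].
have hsP : perm_eq (hs1 ++ hs2) (enum H) by rewrite perm_filterC.
have s1 : size hs1 == 2.
  rewrite size_filter -sum1_count big_mkcond -[X in _ == X]dlE.
  by apply: sum_H; rewrite bL // inE eqxx.
have s2 : size hs2 == 2.
  have := perm_size hsP; rewrite size_cat -cardE hH (eqP s1) dlE.
  by move/eqP; rewrite -[2 * 2]/(2 + 2) eqn_add2l.
have A1 : all (fun x => e x b1) hs1 by apply: filter_all.
have A2 : all (fun x => ~~ e x b1) hs2 by apply: filter_all.
case: hs1 hs2 s1 s2 A1 A2 hsP => [|p [|q []]] //= [|s [|t []]] //= _ _.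
move=> /and3P[ep1 eq1 _] /and3P[es1 et1 _] hsP.
have hH' x : x \in [:: p; q; s; t] -> x \in H by rewrite (perm_mem hsP) mem_enum.
have rL x : x \in [:: p; q; s; t] -> e x b1 + (e x b2 + (e x b3 + (e x b4 + 0))) == 2.
  by move=> /hH' /sum_L; rewrite EL !big_cons big_nil dlE.
have rH b : b \in [:: b1; b2; b3; b4] -> e p b + (e q b + (e s b + (e t b + 0))) == 2.
  by move=> /bL /sum_H; rewrite -(perm_big _ hsP) !big_cons big_nil dlE.
have mem4 (x y z w : V) : [/\ x \in [:: x; y; z; w], y \in [:: x; y; z; w],
    z \in [:: x; y; z; w] & w \in [:: x; y; z; w]] by rewrite !inE !eqxx !orbT.
have [mp mq ms mt] := mem4 p q s t; have [_ m2 m3 m4] := mem4 b1 b2 b3 b4.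
have emb := @split8_embeds p.
have hsP' : perm_eq [:: p; q; t; s] (enum H).
  by apply: perm_trans hsP; rewrite !perm_cons (perm_catC [:: t] [:: s]).
have P3 x y z : perm_eq [:: x; y; z] [:: b2; b3; b4] ->
    perm_eq [:: b1; x; y; z] (enum L) by rewrite EL perm_cons.
(* Here [b1] is adjacent to [p], [q]. In the 8-cycle [x] is adjacent to [p] and one of [s], [t], [y]
   to [q] and the other one, and [z] to both [s] and [t]. *)
have A hs3 hs4 x y z : (hs3, hs4) = (s, t) \/ (hs3, hs4) = (t, s) ->
    perm_eq [:: x; y; z] [:: b2; b3; b4] ->
    e p x -> e hs3 x -> ~~ e q x -> ~~ e hs4 x ->
    ~~ e p y -> ~~ e hs3 y -> e q y -> e hs4 y ->
    ~~ e p z -> ~~ e q z -> e hs3 z -> e hs4 z -> embeds A8 e (H :|: L).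
  move=> st /P3 lsP epx e3x /negbTE eqx /negbTE e4x /negbTE epy /negbTE e3y eqy e4y.
  move=> /negbTE epz /negbTE eqz e3z e4z.
  have hs34 : [/\ perm_eq [:: p; q; hs3; hs4] (enum H), e hs3 b1 = false
                & e hs4 b1 = false].
    by case: st => -[-> ->]; rewrite (negbTE es1) (negbTE et1).
  have [hs34P e31 e41] := hs34.
  by apply: (emb _ _ _ hs34P lsP) => // -[|[|[|[|//]]]] [|[|[|[|//]]]] _ _ /=.
have B x y z : perm_eq [:: x; y; z] [:: b2; b3; b4] ->
    e p x -> e q x -> ~~ e s x -> ~~ e t x ->
    ~~ e p y -> ~~ e q y -> e s y -> e t y ->
    ~~ e p z -> ~~ e q z -> e s z -> e t z -> embeds B8 e (H :|: L).
  move=> /P3 lsP epx eqx /negbTE esx /negbTE etx /negbTE epy /negbTE eqy esy ety.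
  move=> /negbTE epz /negbTE eqz esz etz.
  move/negbTE: es1 => es1; move/negbTE: et1 => et1.
  by apply: (emb _ _ _ hsP lsP) => // -[|[|[|[|//]]]] [|[|[|[|//]]]] _ _ /=.
have q1 := perm_refl [:: b2; b3; b4].
have q2 : perm_eq [:: b2; b4; b3] [:: b2; b3; b4].
  by rewrite perm_cons (perm_catC [:: b4] [:: b3]).
have q3 : perm_eq [:: b3; b4; b2] [:: b2; b3; b4].
  by rewrite (perm_catC [:: b3; b4] [:: b2]).
have q4 : perm_eq [:: b4; b2; b3] [:: b2; b3; b4].
  by rewrite (perm_catC [:: b4] [:: b2; b3]).
have q5 : perm_eq [:: b3; b2; b4] [:: b2; b3; b4].
  by rewrite (perm_cat2r [:: b4] [:: b3; b2] [:: b2; b3]) (perm_catC [:: b3] [:: b2]).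
have q6 : perm_eq [:: b4; b3; b2] [:: b2; b3; b4].
  by apply: perm_trans q3; rewrite (perm_cat2r [:: b2] [:: b4; b3] [:: b3; b4])
     (perm_catC [:: b4] [:: b3]).
have st := or_introl (erefl (s, t)) : (s, t) = (s, t) \/ (s, t) = (t, s).
have ts := or_intror (erefl (t, s)) : (t, s) = (s, t) \/ (t, s) = (t, s).
(* The 0-1 matrix is enumerated column by column; only line sums 2 survive. What remains fits [A] or
   [B] up to permuting [b2], [b3], [b4] and, for [A], exchanging [s] and [t]. *)
move: (rL p mp) (rL q mq) (rL s ms) (rL t mt); rewrite ep1 eq1 (negbTE es1) (negbTE et1).
move: (rH b2 m2); case x1: (e p b2); case x2: (e q b2); case x3: (e s b2);
  case x4: (e t b2) => // _.
all: move: (rH b3 m3); case y1: (e p b3); case y2: (e q b3); case y3: (e s b3);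
  case y4: (e t b3) => // _.
all: move: (rH b4 m4); case z1: (e p b4); case z2: (e q b4); case z3: (e s b4);
  case z4: (e t b4) => // _.
all: move=> // _ _ _ _.
all: pose E := (x1, x2, x3, x4, y1, y2, y3, y4, z1, z2, z3, z4).
all: first [
  by constructor 2; apply: (A s t _ _ _ st q1); rewrite ?E |
  by constructor 2; apply: (A s t _ _ _ st q2); rewrite ?E |
  by constructor 2; apply: (A s t _ _ _ st q3); rewrite ?E |
  by constructor 2; apply: (A s t _ _ _ st q4); rewrite ?E |
  by constructor 2; apply: (A s t _ _ _ st q5); rewrite ?E |
  by constructor 2; apply: (A s t _ _ _ st q6); rewrite ?E |
  by constructor 2; apply: (A t s _ _ _ ts q1); rewrite ?E |
  by constructor 2; apply: (A t s _ _ _ ts q2); rewrite ?E |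
  by constructor 2; apply: (A t s _ _ _ ts q3); rewrite ?E |
  by constructor 2; apply: (A t s _ _ _ ts q4); rewrite ?E |
  by constructor 2; apply: (A t s _ _ _ ts q5); rewrite ?E |
  by constructor 2; apply: (A t s _ _ _ ts q6); rewrite ?E |
  by constructor 3; apply: (B _ _ _ q1); rewrite ?E |
  by constructor 3; apply: (B _ _ _ q3); rewrite ?E |
  by constructor 3; apply: (B _ _ _ q4); rewrite ?E ].
Qed.

End Structure.
End Realizations.

(** * Layered decompositions *)

Section Induced.
Variables (G : sgraph) (X : {set G}).
Definition induced_adj : rel {x | x \in X} := fun x y => adj (val x) (val y).
Lemma induced_sym : symmetric induced_adj.
Proof. by move=> x y; apply: adj_sym. Qed.
Lemma induced_irr : irreflexive induced_adj.
Proof. by move=> x; apply: adj_irr. Qed.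
Definition induced : sgraph := SGraph induced_sym induced_irr.

Lemma embeds_iso (S : sgraph) : embeds S (@adj G) X -> iso induced S.
Proof.
case=> f [fI fE fX]; apply: iso_sym.
have fXP x : f x \in X by rewrite -fX imset_f ?inE.
exists (fun x : S => Sub (f x) (fXP x) : induced) => //.
apply: inj_card_bij => [x y /(congr1 val)/fI //|].
by rewrite card_sig -fX (card_imset _ fI) cardsT.
Qed.
End Induced.

Definition layer (V : finType) (rho : V -> nat) i := [set x | rho x == i].

(* [rho] is the index of the piece containing a vertex, and equals [p] on [C]. *)
Definition layered (V : finType) (e : rel V) :=
  exists (p : nat) (rho : V -> nat) (K : {set V}),
  [/\ forall x, rho x <= p,
      forall i, i < p -> [\/ embeds P4 e (layer rho i), embeds A8 e (layer rho i)
                           | embeds B8 e (layer rho i)],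
      forall x y, rho x = rho y -> rho x < p ->
        (x \in K -> y \in K -> x != y -> e x y) /\
        (x \notin K -> y \notin K -> ~~ e x y),
      [\/ #|layer rho p| = 0, #|layer rho p| = 1 | embeds C5 e (layer rho p)]
    & forall x y, rho x < rho y -> e x y = (x \in K)].

(** [layered] describes the decomposition inside one vertex type, which suits induction. The pieces
    become the induced subgraphs on the layers, and forgetting the index is the isomorphism [h]. *)
Lemma layered_elementary (G : sgraph) :
  layered (@adj G) -> elementary_sc_pseudo_split G.
Proof.
case=> p [rho [K [rho_le piece split core cross]]].
pose S (i : 'I_p) := induced (layer rho i).
pose KS i : {set S i} := [set y | val y \in K].
pose C := induced (layer rho p).
exists p, S, KS, C; split.
- move=> i; have := piece i (ltn_ord i).
  by case=> /embeds_iso ?; [constructor 1 | constructor 2 | constructor 3].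
- have rhoS i (x : S i) : rho (val x) = i.
    by apply/eqP; have := valP x; rewrite inE.
  move=> i; split=> x y; rewrite !inE => xK yK.
    have [||+ _] := split (val x) (val y); rewrite ?rhoS //.
    by move=> + nxy; apply.
  by have [||_] := split (val x) (val y); rewrite ?rhoS //; apply.
- have cC : #|C| = #|layer rho p| by apply: card_sig.
  by rewrite cC; move: core; case=> [?|?|/embeds_iso ?];
    [constructor 1 | constructor 2 | constructor 3].
apply: iso_sym.
pose h (u : compose KS C) : G :=
  match u with inl v => val (tagged v) | inr c => val c end.
have rhoS i (x : S i) : rho (val x) = i.
  by apply/eqP; have := valP x; rewrite inE.
have rhoC (c : C) : rho (val c) = p.
  by apply/eqP; have := valP c; rewrite inE.
have hI : injective h.
  case=> [[i x]|c] [[j y]|c'] //=.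
  - move=> exy; have eij : i = j 
      by apply: val_inj; rewrite /= -[LHS](rhoS _ x) -[RHS](rhoS _ y); congr rho.
    by case: _ / eij y exy => y /val_inj ->.
  - by move=> E; have := ltn_ord i; rewrite -[X in X < _](rhoS _ x) (congr1 rho E) rhoC ltnn.
  - by move=> E; have := ltn_ord j; rewrite -[X in X < _](rhoS _ y) -(congr1 rho E) rhoC ltnn.
  - by move/val_inj->.
exists h.
  apply: inj_card_bij => //; rewrite -(card_codom hI).
  apply/subset_leq_card/subsetP => x _; apply/codomP.
  have := rho_le x; rewrite leq_eqVlt => /orP[/eqP rx|rx].
    have xC : x \in layer rho p by rewrite inE rx.
    by exists (inr (Sub x xC : C)).
  have xS : x \in layer rho (Ordinal rx) by rewrite inE.
  by exists (inl (Tagged (fun i => S i : Type) (Sub x xS : S (Ordinal rx)))).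
case=> [[i x]|c] [[j y]|c'] //=; rewrite /in_clique /= ?inE.
- have [eij|nij] := eqVneq i j.
    by case: _ / eij y => y; rewrite tagged_asE.
  have : val i != val j by [].
  case: ltngtP => // ij _.
    rewrite cross ?rhoS //; case: (val x \in K); case: (val y \in K) => //=.
  rewrite adj_sym cross ?rhoS //; case: (val x \in K); case: (val y \in K) => //=.
- by rewrite cross ?rhoS ?rhoC.
- by rewrite adj_sym cross ?rhoS ?rhoC.
Qed.

(** * The regular case *)

Lemma handshake (V : finType) (e : rel V) : symmetric e -> irreflexive e ->
  ~~ odd (\sum_x #|[set y | e x y]|).
Proof.
move=> sym irr; pose r (x : V) := enum_rank x.
(* Ordering the vertices by [enum_rank] splits the degree sum into two equal parts. *)
have -> : \sum_x #|[set y | e x y]| =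
    \sum_x \sum_y (e x y && (r x < r y)) + \sum_x \sum_y (e x y && (r y < r x)).
  rewrite -big_split; apply: eq_bigr => x _; rewrite -big_split -sum1_card big_mkcond.
  apply: eq_bigr => y _; rewrite inE /=.
  have [<-|nxy] := eqVneq x y; first by rewrite irr.
  have : r x != r y by rewrite (inj_eq enum_rank_inj).
  by rewrite -val_eqE /=; case: ltngtP => // _ _; case: (e x y).
set S := \sum_x _; suff -> : \sum_x \sum_y (e x y && (r y < r x)) = S.
  by rewrite addnn odd_double.
rewrite exchange_big; apply: eq_bigr => y _; apply: eq_bigr => x _.
by rewrite sym.
Qed.

(* Two cliques of order [2k], each split into halves; the vertices of the first
   halves are joined to [None], and the second halves are matched. *)
Section TwoCliques.
Variable k : nat.
Definition two_cliques_vertex : finType := option (bool * (bool * 'I_k)).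
Definition two_cliques : rel two_cliques_vertex := fun x y =>
  match x, y with
  | None, None => false
  | None, Some u | Some u, None => u.2.1
  | Some u, Some v =>
      if u.1 == v.1 then u.2 != v.2 else [&& ~~ u.2.1, ~~ v.2.1 & u.2.2 == v.2.2]
  end.

Lemma two_cliques_sym : symmetric two_cliques.
Proof.
case=> [[s [t i]]|] [[s' [t' i']]|] //=.
by rewrite eq_sym [X in if _ then ~~ X else _]eq_sym [i == _]eq_sym andbCA.
Qed.

Lemma two_cliques_irr : irreflexive two_cliques.
Proof. by case=> [[s [t i]]|] //=; rewrite !eqxx. Qed.

Lemma card_two_cliques_vertex : #|two_cliques_vertex| = (4 * k).+1.
Proof. by rewrite card_option !card_prod !card_bool card_ord; lia. Qed.

(** Besides the [2 * k - 1] other vertices of its clique, a vertex has the single neighbour [far];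
    [None] has [k] neighbours in each clique. *)
Lemma two_cliques_regular x : #|[set y | two_cliques x y]| = 2 * k.
Proof.
have cD z : #|[set~ z : bool * 'I_k]|.+1 = 2 * k.
  rewrite cardsC1 card_prod card_bool card_ord prednK //.
  by case: z => _ [i /(leq_ltn_trans (leq0n i))]; rewrite muln_gt0.
have SI (s : bool) : injective (fun z : bool * 'I_k => Some (s, z)) by move=> ? ? [].
case: x => [[s [t i]]|].
  pose far : two_cliques_vertex := if t then None else Some (~~ s, (false, i)).
  have -> : [set y | two_cliques (Some (s, (t, i))) y] =
      far |: [set Some (s, z) | z in [set~ (t, i)]].
    apply/setP => y; rewrite !inE; apply/idP/orP.
      case: y => [[s' [t' i']]|] /=; last by rewrite /far => ->; left.
      have [<- ne|ns /and3P[/negbTE t0 /negbTE t0' /eqP <-]] := eqVneq s s'.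
        by right; apply/imsetP; exists (t', i') => //; rewrite !inE eq_sym.
      left; rewrite /far t0 t0'; have -> : s' = ~~ s by case: (s) (s') ns => [] [].
      by rewrite eqxx.
    case=> [/eqP ->|/imsetP[[t' i']]]; last first.
      by rewrite !inE eq_sym => ne -> /=; rewrite eqxx.
    by rewrite /far {far}; case: t => //=; case: s; rewrite /= eqxx.
  rewrite cardsU1 card_imset // -(cD (t, i)) -add1n; congr addn.
  have -> // : far \notin [set Some (s, z) | z in [set~ (t, i)]].
  by apply/imsetP => -[z _]; rewrite /far {far}; case: t => //; case: s.
have -> : [set y | two_cliques None y] =
    Some @: setX [set: bool] (setX [set true] [set: 'I_k]).
  apply/setP => y; rewrite !inE; apply/idP/imsetP.
    by case: y => // -[s [t i]] /= tT; exists (s, (t, i)) => //; rewrite !inE tT.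
  by case=> -[s [t i]]; rewrite !inE /= andbT => /eqP -> ->.
by rewrite card_imset; [rewrite !cardsX !cardsT cards1 card_bool card_ord mul1n | move=> ? ? []].
Qed.

(** The image of a clique of order [2 * k] would be an independent set, but such a set contains at
    most one vertex of each clique and possibly [None]: at most 3 < [2 * k] vertices. *)
Lemma two_cliques_antimorphism s : 1 < k -> ~ antimorphism two_cliques s.
Proof.
move=> k2 [sI sE]; pose U := [set u : bool * 'I_k | true].
pose side (z : bool * 'I_k) : option bool := omap fst (s (Some (true, z))).
have /leq_card : injective side.
  move=> z z'; rewrite /side => E; apply/eqP/negPn/negP => nz.
  have nz' : Some (true, z) != Some (true, z') :> two_cliques_vertex.
    by apply: contra nz => /eqP[->].
  have := sE _ _ nz'; rewrite /= nz /=.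
  have : s (Some (true, z)) != s (Some (true, z')) by rewrite (inj_eq sI).
  case: (s _) E => [[a u]|]; case: (s _) => [[a' u']|] //= [->].
  by rewrite eqxx => ne /negbFE/eqP uu; case/eqP: ne; rewrite uu.
by rewrite card_option card_prod !card_bool card_ord; lia.
Qed.
End TwoCliques.

Lemma antimorphism_preim (V W : finType) (e : rel W) (f : V -> W) (s : V -> V) :
  bijective f -> antimorphism (relpre f e) s -> exists s', antimorphism e s'.
Proof.
case=> g fK gK [sI sE]; exists (f \o s \o g); split=> [x y|x y nxy] /=.
  by move/(can_inj fK)/sI/(can_inj gK).
by have := sE (g x) (g y); rewrite /= !gK (can_eq gK) => ->.
Qed.

Lemma realizes_preim (V W : finType) (e : rel W) (f : V -> W) k :
  bijective f -> realizes (fun=> k) e -> realizes (fun=> k) (relpre f e).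
Proof.
move=> fB [sym irr eD]; split=> [x y|x|x] /=; [exact: sym | exact: irr |].
rewrite -(eD (f x)) -(card_imset _ (bij_inj fB)); apply: eq_card => y.
apply/imsetP/idP => [[z]|]; first by rewrite !inE => ? ->.
case: fB => g fK gK; rewrite inE -[y]gK => fxy.
by exists (g y); rewrite ?inE.
Qed.

Lemma C5_embeds (V : finType) (e : rel V) (a b c d f : V) : symmetric e -> irreflexive e ->
  #|V| = 5 -> uniq [:: a; b; c; d; f] ->
  e a b -> e b c -> e c d -> e d f -> e f a ->
  ~~ e a c -> ~~ e b d -> ~~ e c f -> ~~ e d a -> ~~ e f b ->
  embeds C5 e [set: V].
Proof.
move=> sym irr V5 uS ab bc cd df fa ac bd cf da fb.
pose s := [:: a; b; c; d; f].
have fI : injective (fun i : C5 => nth a s (val i)).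
  move=> [i i5] [j j5] /= /eqP; rewrite nth_uniq // => /eqP ij.
  exact: val_inj.
exists (fun i : C5 => nth a s (val i)); split=> //.
  pose E := (irr, ab, bc, cd, df, fa, negbTE ac, negbTE bd, negbTE cf, negbTE da, negbTE fb).
  by move=> [[|[|[|[|[|//]]]]] ?] [[|[|[|[|[|//]]]]] ?] /=; rewrite ?E // sym ?E.
apply/eqP; rewrite eqEcard subsetT /= card_imset //.
by rewrite !cardsT V5 card_ord.
Qed.

(** A 2-regular graph on five vertices is a 5-cycle. The final alternatives are the 12 cyclic
    orders, up to reversal, of five labelled vertices. *)
Lemma regular5_embeds (V : finType) (e : rel V) : symmetric e -> irreflexive e ->
  #|V| = 5 -> (forall x, #|[set y | e x y]| = 2) -> embeds C5 e [set: V].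
Proof.
move=> sym irr V5 eD; have := V5; rewrite cardE.
have := enum_uniq V; case E: (enum V) => [|a [|b [|c [|d [|f []]]]]] //= uS _.
have deg x : e x a + (e x b + (e x c + (e x d + (e x f + 0)))) == 2.
  rewrite -(eD x) -sum1_card big_mkcond -big_enum E !big_cons big_nil /= !inE.
  by case: (e x a); case: (e x b); case: (e x c); case: (e x d); case: (e x f).
have C5e := @C5_embeds V e _ _ _ _ _ sym irr V5.
move: uS; rewrite !inE !negb_or.
case/and5P=> /and4P[ab ac ad af] /and3P[bc bd bf] /andP[cd cf] df _.
have nE (u v : V) : u != v -> ((u == v) = false) * ((v == u) = false).
  by move=> uv; rewrite [v == u]eq_sym (negbTE uv).
pose N := (nE _ _ ab, nE _ _ ac, nE _ _ ad, nE _ _ af, nE _ _ bc, nE _ _ bd,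
           nE _ _ bf, nE _ _ cd, nE _ _ cf, nE _ _ df).
have db := deg b; have dc := deg c; have dd := deg d; have df' := deg f.
move: (deg a) db dc dd df'.
rewrite !irr ![e b a]sym ![e c a]sym ![e d a]sym ![e f a]sym ![e c b]sym ![e d b]sym
  ![e f b]sym ![e d c]sym ![e f c]sym ![e f d]sym.
case x1: (e a b); case x2: (e a c); case x3: (e a d); case x4: (e a f) => // _.
all: case x5: (e b c); case x6: (e b d); case x7: (e b f) => // _.
all: case x8: (e c d); case x9: (e c f) => // _.
all: case x10: (e d f) => // _ _.
all: have X := (x1, x2, x3, x4, x5, x6, x7, x8, x9, x10).
all: first [by apply: (C5e a b c d f); rewrite /= ?inE ?N ?X // sym ?X |
  by apply: (C5e a b c f d); rewrite /= ?inE ?N ?X // sym ?X |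
  by apply: (C5e a b d c f); rewrite /= ?inE ?N ?X // sym ?X |
  by apply: (C5e a b d f c); rewrite /= ?inE ?N ?X // sym ?X |
  by apply: (C5e a b f c d); rewrite /= ?inE ?N ?X // sym ?X |
  by apply: (C5e a b f d c); rewrite /= ?inE ?N ?X // sym ?X |
  by apply: (C5e a c b d f); rewrite /= ?inE ?N ?X // sym ?X |
  by apply: (C5e a c b f d); rewrite /= ?inE ?N ?X // sym ?X |
  by apply: (C5e a c d b f); rewrite /= ?inE ?N ?X // sym ?X |
  by apply: (C5e a c f b d); rewrite /= ?inE ?N ?X // sym ?X |
  by apply: (C5e a d b c f); rewrite /= ?inE ?N ?X // sym ?X |
  by apply: (C5e a d c b f); rewrite /= ?inE ?N ?X // sym ?X ].
Qed.

(** There is no piece, and [C] is the whole graph. The handshake lemma makes [k] even, as the order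
    is odd; with [k = 2 * j] the order is 1, 5, or large enough for [two_cliques] to be a
    realization without antimorphism. *)
Lemma regular_layered (V : finType) (e : rel V) k : symmetric e -> irreflexive e ->
  (forall x, #|[set y | e x y]| = k) -> #|V| = (2 * k).+1 ->
  (forall e', realizes (fun=> k) e' -> exists s : V -> V, antimorphism e' s) ->
  layered e.
Proof.
move=> sym irr eD Vk forced.
have k_even : ~~ odd k.
  have := handshake sym irr; under eq_bigr do rewrite eD.
  by rewrite sum_nat_const -[#|_|]/#|V| Vk oddM /= mul2n odd_double.
have [j kE] : exists j, k = 2 * j by exists k./2; lia.
have layer0 : layer (fun _ : V => 0) 0 = [set: V] by apply/setP => x; rewrite !inE.
exists 0, (fun=> 0), set0; split=> //; rewrite layer0.
case: (ltngtP j 1) => [j0|j1|j1].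
- by constructor 2; rewrite cardsT Vk; lia.
- have WV : #|V| = #|two_cliques_vertex j| by rewrite card_two_cliques_vertex; lia.
  pose f x := enum_val (cast_ord WV (enum_rank x)).
  have fB : bijective f.
    apply: inj_card_bij; last by rewrite WV.
    by move=> x y /enum_val_inj/cast_ord_inj/enum_rank_inj.
  have twoR : realizes (fun=> k) (@two_cliques j).
    split; [exact: two_cliques_sym | exact: two_cliques_irr |].
    by move=> x; rewrite two_cliques_regular.
  have [s] := forced _ (realizes_preim fB twoR).
  by case/(antimorphism_preim fB) => s' /(two_cliques_antimorphism j1).
- constructor 3; apply: regular5_embeds => // [|x]; first by lia.
  by rewrite eD; lia.
Qed.

(** * Recursion on the vertices outside [H] and [L] *)

Lemma embeds_sub (S : sgraph) (V W : finType) (e : rel W) (f : V -> W)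
    (X : {set V}) :
  injective f -> embeds S (relpre f e) X -> embeds S e (f @: X).
Proof.
move=> fI [g [gI gE gX]]; exists (f \o g); split=> [|x y|].
- exact: inj_comp.
- exact: gE.
- by rewrite -gX imset_comp.
Qed.

Section Extension.
Variables (V : finType) (e : rel V) (M : {set V}).
Let W := {x | x \in M}.

(** Only the pairs inside [M] are taken from [e'], so a realization of the degrees of the subgraph
    on [M] extends to one of the whole. *)
Definition graft (e' : rel W) : rel V := fun x y =>
  match insub x, insub y with Some u, Some v => e' u v | _, _ => e x y end.

Lemma graft_in e' (u v : W) : graft e' (val u) (val v) = e' u v.
Proof. by rewrite /graft !valK. Qed.

Lemma graft_out e' x y : (x \notin M) || (y \notin M) -> graft e' x y = e x y.
Proof.
rewrite /graft; case: insubP => // u -> _ /= yM.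
by rewrite insubF // (negbTE yM).
Qed.

Lemma graft_realizes e' : symmetric e -> irreflexive e ->
  realizes (fun x : W => #|[set y : W | e (sval x) (sval y)]|) e' ->
  realizes (fun x => #|[set y | e x y]|) (graft e').
Proof.
move=> sym irr [sym' irr' e'D]; split.
- move=> x y; rewrite /graft; case: insubP => [u _ _|_]; case: insubP => [v _ _|_] //.
- by move=> x; rewrite /graft; case: insubP.
move=> x; rewrite -(cardsID M) -[RHS](cardsID M); congr addn; last first.
  by apply: eq_card => y; rewrite !inE; case yM: (y \in M) => //=; rewrite graft_out ?yM ?orbT.
have inM (r : rel V) : [set y | r x y] :&: M = val @: [set v : W | r x (val v)].
  apply/setP => y; rewrite !inE; apply/andP/imsetP => [[xy yM]|[v]].
    by exists (Sub y yM : W); rewrite ?inE.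
  by rewrite inE => ? ->; split=> //; apply: valP.
rewrite !inM !(card_imset _ val_inj).
have [xM|xM] := boolP (x \in M); last by apply: eq_card => v; rewrite !inE graft_out ?xM.
have := e'D (Sub x xM); rewrite /= => <-; apply: eq_card => v.
by rewrite !inE -[x]/(val (Sub x xM : W)) graft_in.
Qed.

Lemma graft_antimorphism e' s : antimorphism (graft e') s ->
  (forall x, x \in M -> s x \in M) -> exists s', antimorphism e' s'.
Proof.
move=> [sI sE] sM; exists (fun u : W => Sub (s (val u)) (sM _ (valP u))); split.
  by move=> u v /(congr1 val)/sI/val_inj.
by move=> u v nuv; rewrite -graft_in /= sE // graft_in.
Qed.
End Extension.

Lemma forced_layered (V : finType) (e : rel V) : symmetric e -> irreflexive e ->
  (forall e', realizes (fun x => #|[set y | e x y]|) e' ->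
     exists s, antimorphism e' s) -> layered e.
Proof.
have [n] := ubnP #|V|; elim: n V e => // n IH V e le_n sym irr forced.
have [V0|V_gt0] := posnP #|V|.
  have noV (x : V) : False by have := fintype0 x V0.
  exists 0, (fun=> 0), set0; split=> [//|//|x|//|x]; try by case: (noV x).
  constructor 1; apply: eq_card0 => x; by case: (noV x).
pose dg x := #|[set y | e x y]|; rewrite -/dg in forced.
have eR : realizes dg e by [].
have [s eS] := forced e eR.
pose D := \max_x dg x; pose dl := #|V|.-1 - D.
have dg_le x : dg x <= D by apply: leq_bigmax.
have [x0 x0D] : exists x, dg x == D.
  by have [x xD] := eq_bigmax dg V_gt0; exists x; rewrite -xD.
have D_dl : (D + dl).+1 = #|V|.
  by have := dg_antimorphism x0 eR eS; move: x0D; rewrite /dl; clear; lia.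
(* The degrees of [x] and [s x] are at most [D] and sum to [D + dl]; if this is at least [2 * D],
   both equal [D] and the graph is regular. *)
have [le_D|dl_lt] := leqP D dl.
  have dgD x : dg x = D.
    by move: (dg_antimorphism x eR eS) D_dl (dg_le x) (dg_le (s x)) le_D; clear; lia.
  apply: (@regular_layered _ _ D) => //.
    by move: (dg_antimorphism x0 eR eS) (dgD x0) (dgD (s x0)); clear; lia.
  move=> e' [sym' irr' e'D]; apply: forced; split=> // x; by rewrite dgD.
pose H := [set x | dg x == D]; pose L := [set x | dg x == dl].
have D_max : exists x, dg x == D by exists x0.
have piece := piece_embeds D_dl dl_lt dg_le forced D_max eR.
have HL x : x \in H -> x \notin L by move=> xH; apply/negP; apply: HL_disj dl_lt _ xH.
have Hadj x y : x \in H -> y \notin L -> x != y -> e x y.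
  exact: (H_adj D_dl dl_lt dg_le forced D_max eR).
have Lnadj x y : x \in L -> y \notin H -> ~~ e x y.
  exact: (L_nadj D_dl dl_lt dg_le forced D_max eR).
have sHe e' s' : realizes dg e' -> antimorphism e' s' -> forall x, (s' x \in H) = (x \in L).
  by move=> e'R e'S x; apply: (anti_H D_dl dl_lt e'R e'S).
have sLe e' s' : realizes dg e' -> antimorphism e' s' -> forall x, (s' x \in L) = (x \in H).
  by move=> e'R e'S x; apply: (anti_L D_dl dl_lt e'R e'S).
have x0H : x0 \in H by rewrite inE.
rewrite -/H -/L in piece; clearbody H L.
pose M := ~: (H :|: L); pose W : finType := {x | x \in M}.
have inM x : (x \in M) = (x \notin H) && (x \notin L) by rewrite !inE negb_or.
have : layered (fun u v : W => e (sval u) (sval v)).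
  apply: IH => [|u v|u|e' e'R].
  - rewrite card_sig; move: le_n; rewrite ltnS; apply: leq_trans.
    apply: (@leq_ltn_trans #|[set~ x0]|); last by rewrite cardsC1 prednK.
    apply/subset_leq_card/subsetP => x; rewrite inM in_setC1.
    by case/andP=> xH _; apply: contraNneq xH => ->.
  - exact: sym.
  - exact: irr.
  (* An antimorphism of the grafted graph exchanges [H] and [L], so it preserves [M] and restricts
     to an antimorphism of [e']. *)
  have gR := graft_realizes sym irr e'R.
  have [s' s'S] := forced _ gR.
  apply: (graft_antimorphism s'S) => x; rewrite !inM.
  by rewrite (sHe _ _ gR s'S) (sLe _ _ gR s'S) andbC.
case=> p [rho [K [rho_le pieces split core cross]]].
(* The default 0 makes [H :|: L] the first layer; the layers of the remaining graph are shifted by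
   one. *)
pose rho' x := if (insub x : option W) is Some u then (rho u).+1 else 0.
pose K' := H :|: [set sval u | u in K].
have rhoM (u : W) : rho' (sval u) = (rho u).+1 by rewrite /rho' -[sval u]/(val u) valK.
have rho0 x : x \notin M -> rho' x = 0.
  by move=> xM; rewrite /rho' insubF // (negbTE xM).
have MP x : x \in M -> exists u : W, x = sval u.
  by move=> xM; exists (Sub x xM : W).
have KM (u : W) : (sval u \in K') = (u \in K).
  have := valP u; rewrite inM inE => /andP[/negbTE -> _] /=.
  by rewrite (mem_imset _ _ val_inj).
have K0 x : x \notin M -> (x \in K') = (x \in H).
  move=> xM; rewrite inE; case: imsetP => [[u _ xu]|_]; last by rewrite orbF.
  by case/negP: xM; rewrite xu; apply: valP.
have layerS i : layer rho' i.+1 = val @: layer rho i.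
  apply/setP => x; rewrite inE; apply/idP/imsetP => [|[u]]; last first.
    by rewrite inE => /eqP ui ->; rewrite rhoM ui.
  have [/MP[u ->]|/rho0 -> //] := boolP (x \in M).
  by rewrite rhoM eqSS => ui; exists u; rewrite ?inE.
have layer0 : layer rho' 0 = H :|: L.
  apply/setP => x; rewrite inE -[RHS]negbK -in_setC -/M.
  by have [/MP[u ->]|/rho0 -> //] := boolP (x \in M); rewrite rhoM.
have embM S X : embeds S (fun u v : W => e (sval u) (sval v)) X ->
    embeds S e (val @: X).
  exact: embeds_sub val_inj.
exists p.+1, rho', K'; split.
- by move=> x; have [/MP[u ->]|/rho0 -> //] := boolP (x \in M); rewrite rhoM ltnS.
- move=> [|i]; rewrite ?layer0 // ltnS layerS => /pieces.
  by case=> /embM ?; [constructor 1 | constructor 2 | constructor 3].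
- move=> x y; have [/MP[u ->]|xM] := boolP (x \in M); last first.
    rewrite rho0 //; have [/MP[v ->]|yM] := boolP (y \in M); first by rewrite rhoM.
    rewrite !K0 // => _ _; split=> [xH yH|xH yH]; first by apply: Hadj => //; apply: HL.
    by apply: Lnadj => //; move: xM; rewrite inM xH /= negbK.
  rewrite rhoM; have [/MP[v ->]|/rho0 -> //] := boolP (y \in M).
  rewrite rhoM !KM => -[uv] lt_p; exact: split.
- rewrite layerS (card_imset _ val_inj).
  by case: core => [?|?|/embM ?]; [constructor 1 | constructor 2 | constructor 3].
move=> x y; have [/MP[u ->]|xM] := boolP (x \in M).
  rewrite rhoM; have [/MP[v ->]|/rho0 -> //] := boolP (y \in M).
  by rewrite rhoM ltnS KM => /cross.
rewrite rho0 // K0 //; have [yM _|/rho0 -> //] := boolP (y \in M).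
move: yM xM; rewrite !inM => /andP[yH yL]; rewrite negb_and !negbK.
have [xH _|xH /= xL] := boolP (x \in H).
  by apply: Hadj => //; apply: contraNneq yH => <-.
exact/negbTE/Lnadj.
Qed.

Theorem theorem1 (d : seq nat) (hd : degree_sequence d) :
  forcibly_self_complementary d <->
  (forall G : sgraph, realization d G -> elementary_sc_pseudo_split G).
Proof.
split=> [forced G Gd|elem G /elem]; last exact: elementary_self_complementary.
apply/layered_elementary/forced_layered; [exact: adj_sym | exact: adj_irr |].
move=> e' [sym' irr' e'D].
(* [e'] keeps the degree of every vertex, hence the degree sequence; the isomorphism with the
   complement is the required antimorphism. *)
have [|f fB fE] := forced (SGraph sym' irr').
  rewrite /realization -Gd /degseq; congr (sort _ _); apply: eq_map => x.
  exact: e'D.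
exists f; split=> [|x y nxy]; first exact: bij_inj.
have := fE x y; rewrite /= /compl_adj (inj_eq (bij_inj fB)) nxy /= => <-.
by rewrite negbK.
Qed.
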